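(* Let $\xi$ be any ordinal; all operators below are bounded linear maps between Banach spaces. (i) For any operators $A:Y\to Z$, $B:X\to Y$, and $C:W\to X$, $\mathbf{p}_\xi(ABC)\leqslant\mathbf{p}_\xi(B)$. (ii) If $A:X\to Y$ is any operator, $q:W\to X$ is a quotient map, and $j:Y\to Z$ is an isometric embedding, then $\mathbf{p}_\xi(jAq)=\mathbf{p}_\xi(A)$. (iii) For any two operators $A,B:X\to Y$, $\mathbf{p}_\xi(A+B)\leqslant\max\{\mathbf{p}_\xi(A),\mathbf{p}_\xi(B)\}$. (iv) For any $1\leqslant p<\infty$, the class of operators $A$ such that $\mathbf{p}_\xi(A)\leqslant p$ is an injective, surjective operator ideal.
   Context: For $K\subset X^*$ $w^*$-compact and $\varepsilon>0$, $s_\varepsilon(K)$ is the set of $x^*\in K$ such that $\operatorname{diam}(V\cap K)>\varepsilon$ for every $w^*$-neighborhood $V$ of $x^*$; $s^0_\varepsilon(K)=K$, $s^{\zeta+1}_\varepsilon(K)=s_\varepsilon(s^\zeta_\varepsilon(K))$, $s_\varepsilon^\zeta(K)=\bigcap_{\eta<\zeta}s^\eta_\varepsilon(K)$ for limit $\zeta$. $Sz(K,\varepsilon)$ is the least $\zeta$ with $s_\varepsilon^\zeta(K)=\varnothing$ ($\infty$ if none), $Sz(K)=\sup_{\varepsilon>0}Sz(K,\varepsilon)$. $Sz_\xi(K,\varepsilon)$ is the least $\beta$ with $s_\varepsilon^{\omega^\xi\beta}(K)=\varnothing$. If $Sz(K)\leqslant\omega^{\xi+1}$ (so that $Sz_\xi(K,\varepsilon)\in\mathbb{N}$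 for all $\varepsilon>0$, $K\ne\varnothing$), $\mathbf{p}_\xi(K)=\limsup_{\varepsilon\to0^+}\frac{\log Sz_\xi(K,\varepsilon)}{|\log\varepsilon|}$; otherwise $\mathbf{p}_\xi(K)=\infty$. For $A:X\to Y$, $\mathbf{p}_\xi(A)=\mathbf{p}_\xi(A^*B_{Y^*})$. A quotient map is an operator $q:W\to X$ for which $X$ is isometrically the quotient of $W$ by $\ker q$. An operator ideal (in the sense of Pietsch) is a class of operators containing finite rank operators, closed under sums and under two-sided composition with bounded operators. It is injective if $jA$ in the class with $j$ an isometric embedding implies $A$ in the class, and surjective if $Aq$ in the class with $q$ a quotient map implies $A$ in the class. *)

(* Defs.v *)
From HB Require Import structures.
From mathcomp Require Import all_boot all_order all_algebra.
From mathcomp Require Import all_classical all_reals all_analysis.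
From mathcomp Require Import complex.

Set Implicit Arguments.
Unset Strict Implicit.
Unset Printing Implicit Defensive.

Import Order.TTheory GRing.Theory Num.Theory.
Import numFieldNormedType.Exports.

Local Open Scope classical_set_scope.
Local Open Scope ring_scope.

(** * Ordinals *)

(* [OSup f] is the (non-strict) supremum of the family [f], and 0 when the
   family is empty.  As [J] is an arbitrary type, every ordinal is denoted by
   some term; distinct terms may denote the same ordinal, equality of ordinals
   being [ole] in both directions. *)
Inductive ord : Type :=
| OZero : ord
| OSucc : ord -> ord
| OSup : forall J : Type, (J -> ord) -> ord.

(* [ole a b] is a <= b.  The inner fixpoint decides a' < c by recursion on c. *)
Fixpoint ole (a b : ord) : Prop :=
  match a with
  | OZero => True
  | OSucc a' =>
      (fix above (c : ord) : Prop :=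
         match c with
         | OZero => False
         | OSucc c' => ole a' c'
         | OSup _ g => exists i, above (g i)
         end) b
  | OSup _ f => forall i, ole (f i) b
  end.

Lemma ole_OSup (J : Type) (g : J -> ord) a j : ole a (g j) -> ole a (OSup g).
Proof.
elim: a => [//|a _ /= h|J' f ih /= h i]; first by exists j.
exact: ih (h i).
Qed.

Lemma olt_ole a b : ole (OSucc a) b -> ole a b.
Proof.
elim: b a => [//|b ihb|J g ihg] a.
  rewrite [X in X -> _]/= => ab; elim: a ab => [//|a _ /= ab|J f ihf /= ab i].
    exact: ihb.
  exact: ihf (ab i).
by move=> [j /ihg]; exact: ole_OSup.
Qed.

Lemma ole_refl a : ole a a.
Proof. by elim: a => [//|//|J f ih] i; exact: ole_OSup (ih i). Qed.

Lemma ole_trans b a c : ole a b -> ole b c -> ole a c.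
Proof.
elim: a b c => [//|a iha|J f ihf] b c; last by move=> fb bc i; exact: ihf (fb i) bc.
elim: b => [//|b _ /= ab|J g ihg [j agj] gc]; last exact: ihg agj (gc j).
elim: c => [//|c _ bc|J g ihg [j bgj]]; first exact: iha bc.
by exists j; exact: ihg.
Qed.

Lemma ole_or_olt a b : ole a b \/ ole (OSucc b) a.
Proof.
elim: a b => [b|a iha b|J f ihf b]; first by left.
- elim: b => [|b _|J g ihg]; [by right|exact: iha|].
  have [[j ?]|nag] := pselect (exists j, ole (OSucc a) (g j)).
    by left; exists j.
  by right=> j; case: (ihg j) => // agj; case: nag; exists j.
- have [?|] := pselect (forall j, ole (f j) b); first by left.
  by move=> /existsNP[j fjb]; right; case: (ihf j b) => // ?; exists j.
Qed.

Definition ofnat (n : nat) : ord := iter n OSucc OZero.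

Definition omega : ord := OSup ofnat.

(* The index [None] makes a + sup f equal to a when the family f is empty. *)
Fixpoint oadd (a b : ord) : ord :=
  match b with
  | OZero => a
  | OSucc b' => OSucc (oadd a b')
  | OSup J f => OSup (fun k : option J => if k is Some i then oadd a (f i) else a)
  end.

Fixpoint omul (a b : ord) : ord :=
  match b with
  | OZero => OZero
  | OSucc b' => oadd (omul a b') a
  | OSup _ f => OSup (fun i => omul a (f i))
  end.

(* [oexp b] is omega ^ b; the index [None] again handles empty families. *)
Fixpoint oexp (b : ord) : ord :=
  match b with
  | OZero => ofnat 1
  | OSucc b' => omul (oexp b') omega
  | OSup J f => OSup (fun k : option J => if k is Some i then oexp (f i) else ofnat 1)
  end.

(** In [option ord], [None] stands for the symbol "infinity" lying above all
    ordinals. *)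

Definition xole (x y : option ord) : Prop :=
  match x, y with
  | _, None => True
  | None, Some _ => False
  | Some a, Some b => ole a b
  end.

Definition xosup (J : Type) (f : J -> option ord) : option ord :=
  if `[< exists i, f i = None >] then None
  else Some (OSup (fun i => odflt OZero (f i))).

Definition is_oleast (P : set ord) (a : ord) : Prop :=
  P a /\ forall b, P b -> ole a b.

Lemma is_oleast_exists (P : set ord) : P !=set0 -> exists a, is_oleast P a.
Proof.
move=> [a Pa]; have := ole_refl a; move: {1 2}a Pa.
suff least_or_lt x : P x ->
    (exists a, is_oleast P a) \/ exists2 b, P b & ole (OSucc b) x.
  elim: a => [|a ih|J f ih] x Px xa; case: (least_or_lt x Px) => // -[b Pb bx].
  - by have := ole_trans bx xa.
  - exact: (ih b Pb (ole_trans bx xa)).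
  - by have [j /olt_ole bfj] := ole_trans bx xa; exact: (ih j b Pb bfj).
move=> Px; have [?|] := pselect (forall b, P b -> ole x b).
  by left; exists x.
by move=> /existsNP[b /not_implyP[Pb xb]]; right; exists b => //;
  case: (ole_or_olt x b).
Qed.

Definition oleast (P : set ord) : option ord :=
  match pselect (exists a, is_oleast P a) with
  | left h => Some (projT1 (cid h))
  | right _ => None
  end.

(* Natural numbers are sent to themselves, infinite ordinals and [None] to the
   infimum of the empty set, i.e., to +oo. *)
Definition xord_ereal (R : realType) (x : option ord) : \bar R :=
  ereal_inf [set n%:R%:E | n in [set n : nat | xole x (Some (ofnat n))]].

(** * Banach spaces and operators *)

Variant scalar_kind := RealScalars | ComplexScalars.

Definition base_field (R : realType) (c : scalar_kind) : numFieldType :=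
  match c with
  | RealScalars => R
  | ComplexScalars => R[i]
  end.

Definition scalar_re (R : realType) (c : scalar_kind) : base_field R c -> R :=
  match c with
  | RealScalars => fun x : R => x
  | ComplexScalars => fun z : R[i] => complex.Re z
  end.

Record operator (K : numFieldType) (X Y : normedModType K) := Operator {
  op_fun :> {linear X -> Y};
  op_continuous : continuous op_fun
}.

HB.instance Definition _ (K : numFieldType) (X Y : normedModType K) :=
  gen_eqMixin (operator X Y).
HB.instance Definition _ (K : numFieldType) (X Y : normedModType K) :=
  gen_choiceMixin (operator X Y).

Section operators.
Context {K : numFieldType}.
Implicit Types X Y Z W : normedModType K.

Lemma op_comp_continuous X Y Z (A : operator Y Z) (B : operator X Y) :
  continuous (A \o B).
Proof.
move=> x; apply: continuous_comp.
  exact: (op_continuous (o := B)).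
exact: (op_continuous (o := A)).
Qed.

Definition op_comp X Y Z (A : operator Y Z) (B : operator X Y) : operator X Z :=
  @Operator K X Z (A \o B) (@op_comp_continuous X Y Z A B).

Lemma op_add_continuous X Y (A B : operator X Y) : continuous (A \+ B).
Proof.
move=> x; apply: cvgD; first exact: (op_continuous (o := A)).
exact: (op_continuous (o := B)).
Qed.

Definition op_add X Y (A B : operator X Y) : operator X Y :=
  @Operator K X Y (A \+ B) (@op_add_continuous X Y A B).

Definition dual X := operator X K^o.

Definition adjoint X Y (A : operator X Y) (g : dual Y) : dual X := op_comp g A.

Definition wstar X : topologicalType :=
  initial_topology (fun f : dual X => (f : X -> K^o) : {ptws X -> K^o}).

Definition finite_rank X Y (A : operator X Y) : Prop :=
  exists (n : nat) (v : 'I_n -> Y), forall x, exists a : 'I_n -> K,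
    A x = \sum_(i < n) a i *: v i.

Definition isometric_embedding X Y (j : operator X Y) : Prop :=
  forall x, `|j x| = `|x|.

End operators.

(** * Operator ideals *)

Definition operator_class (K : numFieldType) :=
  forall X Y : completeNormedModType K, operator X Y -> Prop.

Record operator_ideal (K : numFieldType) (U : operator_class K) : Prop := {
  ideal_finite_rank : forall (X Y : completeNormedModType K) (A : operator X Y),
    finite_rank A -> U X Y A;
  ideal_add : forall (X Y : completeNormedModType K) (A B : operator X Y),
    U X Y A -> U X Y B -> U X Y (op_add A B);
  ideal_comp : forall (W X Y Z : completeNormedModType K)
    (A : operator Y Z) (B : operator X Y) (C : operator W X),
    U X Y B -> U W Z (op_comp A (op_comp B C))
}.

Definition injective_class (K : numFieldType) (U : operator_class K) : Prop :=
  forall (X Y Z : completeNormedModType K)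
    (A : operator X Y) (j : operator Y Z),
    isometric_embedding j -> U X Z (op_comp j A) -> U X Y A.

Section szlenk.
Context {R : realType} {c : scalar_kind}.
Local Notation K := (base_field R c).
Implicit Types X Y W : normedModType K.

Definition rnorm X (x : X) : R := scalar_re `|x|.

(* W / ker q carries the norm of the coset w + ker q, which is the distance
   from w to ker q. *)
Definition quotient_map W X (q : operator W X) : Prop :=
  (forall x, exists w, q w = x) /\
  forall w, rnorm (q w) = inf [set rnorm (w - k) | k in [set k | q k = 0]].

Definition opnorm X Y (f : X -> Y) : \bar R :=
  ereal_sup [set (rnorm (f x))%:E | x in [set x | rnorm x <= 1]].

Definition dual_ball X : set (dual X) := [set f | (opnorm f <= 1)%E].

Definition diam X (S : set (dual X)) : \bar R :=
  ereal_sup [set opnorm (fun x => fg.1 x - fg.2 x : K^o) | fg in S `*` S].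

Definition szlenk_derivation X (eps : R) (S : set (dual X)) : set (dual X) :=
  [set f | S f /\ forall V, nbhs (f : wstar X) V -> (eps%:E < diam (V `&` S))%E].

(* Intersecting with S only matters for the empty supremum.  The usual clause
   for limit ordinals is [szlenk_iter_limit]. *)
Fixpoint szlenk_iter X (eps : R) (S : set (dual X)) (z : ord) : set (dual X) :=
  match z with
  | OZero => S
  | OSucc z' => szlenk_derivation eps (szlenk_iter eps S z')
  | OSup _ f => S `&` \bigcap_i szlenk_iter eps S (f i)
  end.

Lemma szlenk_derivation_subset X eps (A B : set (dual X)) : A `<=` B ->
  szlenk_derivation eps A `<=` szlenk_derivation eps B.
Proof.
move=> AB f [Af fA]; split; first exact: AB.
move=> V /fA /lt_le_trans; apply.
by apply: ereal_sup_le => _ /= [fg [[? ?] [? ?]] <-] ;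
  exists fg => //; do !split => //; exact: AB.
Qed.

Lemma szlenk_iter_subset X eps (S : set (dual X)) a b : ole a b ->
  szlenk_iter eps S b `<=` szlenk_iter eps S a.
Proof.
have iter0 d : szlenk_iter eps S d `<=` S.
  by elim: d => [//|d ih f [/ih]//|J f ih g []].
elim: a b => [b _|a iha b|J f ihf b fb]; first exact: iter0.
  elim: b => [//|b _ ab|J g ihg [j agj] h [_ /(_ j Logic.I)]]; last exact: ihg.
  exact/szlenk_derivation_subset/iha.
by move=> h bh; split; [exact: iter0 bh|move=> j _; exact: ihf (fb j) _ bh].
Qed.

Lemma szlenk_iter_limit X eps (S : set (dual X)) z : ole (OSucc OZero) z ->
  (forall b, ole (OSucc b) z -> ole (OSucc (OSucc b)) z) ->
  szlenk_iter eps S z =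
  \bigcap_(b in [set b | ole (OSucc b) z]) szlenk_iter eps S b.
Proof.
move=> z0 zlim; rewrite eqEsubset; split.
  by move=> f zf b /olt_ole /szlenk_iter_subset; exact.
elim: z z0 zlim => [//|z _ _ zlim|J f ih z0 zlim] g gz.
  have lt_irr: forall a, ~ ole (OSucc a) a.
    elim=> [//|//|J f ih [j jf]]; apply: (ih j).
    apply: (@ole_trans (OSucc (OSup f))) jf.
    exact: (@ole_OSup _ f _ j (ole_refl _)).
  by case: (lt_irr z); exact: (zlim z (ole_refl z)).
have [[j zfj]|nz] := pselect (exists j, ole (OSup f) (f j)).
  apply: (szlenk_iter_subset zfj); apply: ih.
  - exact: (@ole_trans (OSup f)) z0 zfj.
  - move=> b bfj; apply: (@ole_trans (OSup f)) zfj; apply: zlim; apply: (@ole_trans (f j)) bfj _.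
    by apply: (@ole_OSup _ f _ j); exact: ole_refl.
  - move=> b bfj; apply: gz; apply: (@ole_trans (f j)) bfj _.
    by apply: (@ole_OSup _ f _ j); exact: ole_refl.
split; first exact: gz OZero z0.
move=> j _; apply: gz; case: (ole_or_olt (OSup f) (f j)) => // zfj.
by case: nz; exists j.
Qed.
Definition Sz_eps X (S : set (dual X)) (eps : R) : option ord :=
  oleast [set z | szlenk_iter eps S z = set0].

Definition Sz X (S : set (dual X)) : option ord :=
  xosup (fun eps : {e : R | 0 < e} => Sz_eps S (sval eps)).

Definition Sz_xi (xi : ord) X (S : set (dual X)) (eps : R) : option ord :=
  oleast [set b | szlenk_iter eps S (omul (oexp xi) b) = set0].

Definition p_set (xi : ord) X (S : set (dual X)) : \bar R :=
  if `[< xole (Sz S) (Some (oexp (OSucc xi))) >] then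
    limf_esup (fun eps : R =>
      lne (xord_ereal R (Sz_xi xi S eps)) * (`|ln eps|^-1)%:E)%E 0^'+
  else +oo%E.

Definition p_op (xi : ord) X Y (A : operator X Y) : \bar R :=
  p_set xi (adjoint A @` @dual_ball Y).

Definition surjective_class (U : operator_class K) : Prop :=
  forall (W X Y : completeNormedModType K)
    (A : operator X Y) (q : operator W X),
    quotient_map q -> U W Y (op_comp A q) -> U X Y A.

End szlenk.

(* Main.v *)
(* [K_A = A^* B_{Y^*}] is weak*-compact by Banach-Alaoglu, and weak*-continuous
   images of compact sets only lose a constant factor in [eps], uniformly over
   all iterates. Hence [K_{ABC}], contained in the image of [K_B] under a
   multiple of [C^*], satisfies (i). By Hahn-Banach, [K_A] is contained in
   [K_{jA}], and [q^*] is an isometry, which gives (ii).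
   For (iii), [K_{A+B}] is contained in the image of [K_A * K_B] under addition.
   If [k] is a power of omega, a point [(x, y)] of the [k n]-th derived set of a
   product lies in the product of the [k i]-th and [k j]-th derived sets for some
   [i + j = n]. So the index of a sum is at most the sum of the indices at
   [eps / 4], and taking logarithms over [|log eps|] turns this into the maximum.
   A finite rank operator is a sum of rank one operators, for which [K_A] lies on
   a line and has no point in its derived set. *)

From HB Require Import structures.
Require Import Defs.
From mathcomp Require Import all_boot all_order all_algebra.
From mathcomp Require Import all_classical all_reals all_analysis.
From mathcomp Require Import complex ring lra.

Set Implicit Arguments.
Unset Strict Implicit.
Unset Printing Implicit Defensive.

Import Order.TTheory GRing.Theory Num.Theory.
Import numFieldNormedType.Exports.
Local Open Scope classical_set_scope.
Local Open Scope ring_scope.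

(** * Derivations of closed sets *)

Lemma ole_total a b : ole a b \/ ole b a.
Proof. by case: (ole_or_olt a b) => [|/olt_ole]; [left|right]. Qed.

Lemma ole_ofnat m n : (m <= n)%N -> ole (ofnat m) (ofnat n).
Proof. by elim: m n => [//|m ih] [//|n]; exact: ih. Qed.

(* [szlenk_derivation eps] is [der far] for the relation [far f g] stating that
   the dual norm of [f - g] exceeds [eps]. *)
Definition der (T : topologicalType) (far : T -> T -> Prop) (S : set T) : set T :=
  [set x | S x /\ forall V, nbhs x V ->
    exists y z, [/\ V y, S y, V z, S z & far y z]].

Fixpoint der_iter (T : topologicalType) (far : T -> T -> Prop) (S : set T)
    (a : ord) : set T :=
  match a with
  | OZero => S
  | OSucc b => der far (der_iter far S b)
  | OSup _ f => S `&` \bigcap_i der_iter far S (f i)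
  end.

Section derivation.
Context {T : topologicalType} {far : T -> T -> Prop}.
Implicit Types (S U : set T) (a b : ord).

Lemma der_mono S S' : S `<=` S' -> der far S `<=` der far S'.
Proof.
move=> SS' x [Sx Sfar]; split; first exact: SS'.
move=> V /Sfar[y [z [Vy Sy Vz Sz yz]]].
by exists y, z; split=> //; exact: SS'.
Qed.

Lemma der_iter_sub S a : der_iter far S a `<=` S.
Proof. by elim: a => [//|a ih x [/ih]|J f ih x []]. Qed.

Lemma der_iter_mono S S' a :
  S `<=` S' -> der_iter far S a `<=` der_iter far S' a.
Proof.
move=> SS'; elim: a => [//|a ih|J f ih x [Sx fx]]; first exact: der_mono.
by split; [exact: SS'|move=> i _; apply: ih; exact: fx].
Qed.

Lemma der_iter_anti S a b : ole a b -> der_iter far S b `<=` der_iter far S a.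
Proof.
elim: a b => [b _|a iha b|J f ihf b fb]; first exact: der_iter_sub.
  elim: b => [//|b _ ab|J g ihg [j agj] h [_ /(_ j Logic.I)]]; last exact: ihg.
  exact/der_mono/iha.
move=> h bh; split; first exact: der_iter_sub bh.
by move=> j _; exact: ihf (fb j) _ bh.
Qed.

Lemma der_iter_add S a b :
  der_iter far S (oadd a b) = der_iter far (der_iter far S a) b.
Proof.
elim: b => [//|b /= -> //|J f ih /=]; rewrite eqEsubset; split=> x.
  (* The index [None] of [oadd] at a supremum contributes exactly the set [der_iter far S a] with
     which the right-hand side is intersected. *)
  by move=> [_ fx]; split=> [|i _]; [exact: fx None _|rewrite -ih; exact: fx (Some i) _].
move=> [Sx fx]; split; first exact: der_iter_sub Sx.
by move=> [i|] _ //; rewrite ih; exact: fx.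
Qed.

(** Argued on the derived sets themselves: by [der_iter_add], one more factor [k] applies the same
    monotone operation to both sides. *)
Lemma der_iter_omul S k a b : ole a b ->
  der_iter far S (omul k b) `<=` der_iter far S (omul k a).
Proof.
elim: a b => [b _|a iha b|J f ihf b fb]; first exact: der_iter_sub.
  elim: b => [//|b _ ab|J g ihg [j agj] h [_ /(_ j Logic.I)]]; last exact: ihg.
  by rewrite /= !der_iter_add; exact/der_iter_mono/iha.
move=> h bh; split; first exact: der_iter_sub bh.
by move=> j _; exact: ihf (fb j) _ bh.
Qed.

Lemma der_closed S : closed S -> closed (der far S).
Proof.
move=> cS x clx; split; first by apply: cS => V /clx [y [[Sy _] Vy]]; exists y.
move=> V; rewrite nbhsE /= => -[U [oU Ux] UV].
have [y [[Sy yfar] Uy]] := clx U (open_nbhs_nbhs (conj oU Ux)).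
have [z [t [Uz Sz Ut St zt]]] := yfar U (open_nbhs_nbhs (conj oU Uy)).
by exists z, t; split=> //; exact: UV.
Qed.

Lemma der_iter_closed S a : closed S -> closed (der_iter far S a).
Proof.
move=> cS; elim: a => [//|a ih|J f ih]; first exact: der_closed.
by apply: closedI => //; apply: closed_bigI.
Qed.

(** Every neighbourhood of a point of [U] can be shrunk into [U], so whether such a point survives
    depends only on the part of [S] inside [U]. *)
Lemma der_iter_local S U a : open U ->
  der_iter far S a `&` U `<=` der_iter far (S `&` U) a.
Proof.
move=> oU; elim: a => [//|a ih x [[Sx xfar] Ux]|J f ih x [[Sx fx] Ux]].
  split; first exact: ih.
  move=> V nV; have nVU : nbhs x (V `&` U) by apply: filterI => //; exact: open_nbhs_nbhs.
  have [y [z [[Vy Uy] Sy [Vz Uz] Sz yz]]] := xfar _ nVU.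
  by exists y, z; split=> //; exact: ih.
by split=> // i _; apply: ih; split=> //; exact: fx.
Qed.

End derivation.

(** * Derivations of continuous images of compact sets *)

Section image.
Context {T T' : topologicalType} (far : T -> T -> Prop) (far' half : T' -> T' -> Prop).
Context (phi : T -> T').
Hypothesis phi_continuous : continuous phi.
Hypothesis T'_hausdorff : hausdorff_space T'.
Hypothesis far'_half : forall x y z, far' x y -> half x z \/ half y z.
Hypothesis half_far : forall x y, half (phi x) (phi y) -> far x y.

(* A point of the fibre over [y] is a cluster point of a net [x_V] with
   [phi x_V] in [V] half-far from [y], so [x_V] is far from it. *)
Lemma der_image S : compact S -> der far' (phi @` S) `<=` phi @` der far S.
Proof.
move=> cS y [Sy yfar].
pose B (V : set T') := S `&` [set x | V (phi x) /\ half (phi x) y].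
pose F := filter_from (nbhs y) B.
have FF : ProperFilter F.
  apply: filter_from_proper.
    apply: filter_from_filter; first by exists setT; exact: filterT.
    move=> V W nV nW; exists (V `&` W); first exact: filterI.
    by move=> x [Sx [[Vx Wx] hx]].
  move=> V /yfar[z1 [z2 [V1 [x1 Sx1 x1z] V2 [x2 Sx2 x2z] /(@far'_half _ _ y)]]].
  by case=> h; [exists x1|exists x2]; rewrite /B /= ?x1z ?x2z.
have FS : F S by exists setT; [exact: filterT|move=> x []].
have [x [Sx clx]] := cS F FF FS.
have phix : phi x = y.
  apply: T'_hausdorff => V W nV nW.
  have FB : F (B W) by exists W.
  have [z [[_ [Wz _]] Vz]] := clx _ _ FB (phi_continuous nV).
  by exists (phi z).
exists x => //; split=> // V nV.
have FB : F (B setT) by exists setT => //; exact: filterT.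
have [z [[Sz [_ hz]] Vz]] := clx _ _ FB nV.
exists z, x; split=> //; first exact: nbhs_singleton.
by apply: half_far; rewrite phix.
Qed.

Lemma closed_fiber y : closed [set x | phi x = y].
Proof.
have := (continuous_closedP phi).1 phi_continuous [set y].
by apply; exact/accessible_closed_set1/hausdorff_accessible.
Qed.

(** Successor steps are [der_image]. At a supremum, the fibre over [y] meets each iterate in a
    nonempty closed set; these sets are nested because [ole] is total, so by compactness they have a
    common point. *)
Lemma der_iter_image S a : closed S -> compact S ->
  der_iter far' (phi @` S) a `<=` phi @` der_iter far S a.
Proof.
move=> clS cS; elim: a => [//|a ih|J f ih].
  have cSa : compact (der_iter far S a).
    apply: subclosed_compact cS (@der_iter_sub _ _ _ _).
    exact: der_iter_closed.
  by move=> y /(der_mono ih) /(der_image cSa).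
move=> y [Sy fy].
(* The index [None] stands for [S] itself and keeps the family nonempty when [J] is empty. *)
pose g (i : option J) := if i is Some i then f i else OZero.
pose B i := der_iter far S (g i) `&` [set x | phi x = y].
have FF : ProperFilter (filter_from setT B).
  apply: filter_from_proper.
    apply: filter_fromT_filter; first by exists None.
    move=> i j; case: (ole_total (g i) (g j)) => gij.
    - by exists j => x [jx xy]; split; split=> //; exact: der_iter_anti jx.
    - by exists i => x [ix xy]; split; split=> //; exact: der_iter_anti ix.
  move=> [i|] _; last by case: Sy => x Sx xy; exists x.
  by have [x ix xy] := ih i y (fy i Logic.I); exists x.
have FS : filter_from setT B S by exists None => // x [].
have [x [Sx clx]] := cS _ FF FS.
have clB i : closure (B i) x by move=> V nV; apply: clx => //; exists i.
have Bx i : B i x.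
  have cB : closed (B i).
    by apply: closedI; [exact: der_iter_closed|exact: closed_fiber].
  exact: cB (clB i).
by exists x; [split=> // i _; have [] := Bx (Some i)|have [] := Bx None].
Qed.

End image.

Lemma closed_setX (T1 T2 : topologicalType) (A : set T1) (B : set T2) :
  closed A -> closed B -> closed (A `*` B).
Proof.
move=> clA clB p clp; split.
- apply: clA => V nV; have [|q [[Aq _] [Vq _]]] := clp (V `*` setT).
    by exists (V, setT) => //; split=> //; exact: filterT.
  by exists q.1.
- apply: clB => V nV; have [|q [[_ Bq] [_ Vq]]] := clp (setT `*` V).
    by exists (setT, V) => //; split=> //; exact: filterT.
  by exists q.2.
Qed.

(** * Derivations of products *)

Section product.
Context {T1 T2 : topologicalType} (far1 : T1 -> T1 -> Prop) (far2 : T2 -> T2 -> Prop).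

(** This is distance for the maximum norm on the product. *)
Definition prod_far (p q : T1 * T2) : Prop := far1 p.1 q.1 \/ far2 p.2 q.2.

(** This can fail for general [k]: of two derivations, one may be spent in each factor. It expresses
    the additive indecomposability of powers of omega. *)
Definition box_bound (k : ord) : Prop :=
  forall (A : set T1) (B : set T2) p, closed A -> closed B ->
  der_iter prod_far (A `*` B) k p -> der_iter far1 A k p.1 \/ der_iter far2 B k p.2.

(** If neither coordinate survives, each has a neighbourhood without far pairs, and the product of
    these neighbourhoods has none either. *)
Lemma box_bound1 : box_bound (ofnat 1).
Proof.
move=> A B [x y] _ _ [[Ax By] pfar]; apply: contrapT => /not_orP[/= nx ny].
have [V nV Vfar] : exists2 V, nbhs x V & forall s t, V s -> A s -> V t -> A t -> ~ far1 s t.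
  apply: contrapT => h; apply: nx; split=> // V nV; apply: contrapT => h'.
  by apply: h; exists V => // s t Vs As Vt At st; apply: h'; exists s, t.
have [W nW Wfar] : exists2 W, nbhs y W & forall s t, W s -> B s -> W t -> B t -> ~ far2 s t.
  apply: contrapT => h; apply: ny; split=> // W nW; apply: contrapT => h'.
  by apply: h; exists W => // s t Ws Bs Wt Bt st; apply: h'; exists s, t.
have nVW : nbhs (x, y) (V `*` W) by exists (V, W).
have [[s1 s2] [[t1 t2] [[/= ? ?] [/= ? ?] [/= ? ?] [/= ? ?] []]]] := pfar _ nVW.
  exact: Vfar.
exact: Wfar.
Qed.

(* Near [p], only one of the boxes that cover the [k n]-th derived set of
   [A `*` B] survives, so that [box_bound k] applies to it alone. *)
Lemma box_boundM k (n : nat) : box_bound k ->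
  forall (A : set T1) (B : set T2) p, closed A -> closed B ->
  der_iter prod_far (A `*` B) (omul k (ofnat n)) p ->
  exists i j : nat, [/\ (i + j)%N = n, der_iter far1 A (omul k (ofnat i)) p.1 &
    der_iter far2 B (omul k (ofnat j)) p.2].
Proof.
move=> bk A B + clA clB; elim: n => [[x y] [Ax By]|n ih p]; first by exists 0%N, 0%N.
pose Ak i := der_iter far1 A (omul k (ofnat i)).
pose Bk i := der_iter far2 B (omul k (ofnat i)).
have clAk i : closed (Ak i) by exact: der_iter_closed.
have clBk i : closed (Bk i) by exact: der_iter_closed.
rewrite -/(ofnat n.+1) [omul _ _]/= der_iter_add => kp.
have [i [j [ijn Ai Bj]]] := ih p (der_iter_sub kp).
have [Ai1|nAi1] := pselect (Ak i.+1 p.1).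
  by exists i.+1, j; split=> //; rewrite addSn ijn.
have [Bj1|nBj1] := pselect (Bk j.+1 p.2).
  by exists i, j.+1; split=> //; rewrite addnS ijn.
exfalso.
pose U : set (T1 * T2) := (~` Ak i.+1) `*` (~` Bk j.+1).
have oU : open U.
  rewrite openE => q [qA qB]; exists (~` Ak i.+1, ~` Bk j.+1) => //=.
  by split; apply: open_nbhs_nbhs; split=> //; exact: closed_openC.
have := der_iter_local oU (conj kp (conj nAi1 nBj1 : U p)).
(* Inside [U] a splitting [i' + j' = n] has [i' <= i] and [j' <= j]; as [i + j = n] too, both are
   equalities. *)
have sub : der_iter prod_far (A `*` B) (omul k (ofnat n)) `&` U `<=` Ak i `*` Bk j.
  move=> q [/ih[i' [j' [ijn' Ai' Bj']]] [nA nB]].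
  have i'i : (i' <= i)%N.
    by rewrite leqNgt; apply/negP => ii'; apply: nA; exact: (der_iter_omul (ole_ofnat _)) Ai'.
  have j'j : (j' <= j)%N.
    by rewrite leqNgt; apply/negP => jj'; apply: nB; exact: (der_iter_omul (ole_ofnat _)) Bj'.
  suff [-> ->] : i = i' /\ j = j' by [].
  by split; apply/eqP; rewrite eqn_leq ?i'i ?j'j andbT;
    [rewrite -(leq_add2r j) ijn -ijn' leq_add2l|rewrite -(leq_add2l i) ijn -ijn' leq_add2r].
move=> /(der_iter_mono sub) /(bk _ _ _ (clAk i) (clBk j)) [].
- by rewrite -der_iter_add; exact: nAi1.
- by rewrite -der_iter_add; exact: nBj1.
Qed.

(** At a successor, if the coordinates die after [m] and [n] blocks of length [oexp xi], then the
    pair dies after [m + n] blocks, which is still before the next power. At a supremum, the larger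
    of the two indices at which the coordinates die gives the contradiction. *)
Lemma box_bound_oexp xi : box_bound (oexp xi).
Proof.
elim: xi => [|xi ih|J f ih]; first exact: box_bound1.
- move=> A B p clA clB /= [ABp kp].
  apply: contrapT => /not_orP[nA nB].
  have [m nAm] : exists m, ~ der_iter far1 A (omul (oexp xi) (ofnat m)) p.1.
    apply: contrapT => h; apply: nA; split; first by case: ABp.
    by move=> m _; apply: contrapT => h'; apply: h; exists m.
  have [n nBn] : exists n, ~ der_iter far2 B (omul (oexp xi) (ofnat n)) p.2.
    apply: contrapT => h; apply: nB; split; first by case: ABp.
    by move=> n _; apply: contrapT => h'; apply: h; exists n.
  have [i [j [ijn Ai Bj]]] := box_boundM ih clA clB (kp (m + n)%N Logic.I).
  have [mi|im] := leqP m i; first by apply: nAm; exact: (der_iter_omul (ole_ofnat _)) Ai.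
  have [nj|jn] := leqP n j; first by apply: nBn; exact: (der_iter_omul (ole_ofnat _)) Bj.
  by have := leq_add (ltnW im) jn; rewrite addnS ijn ltnn.
- move=> A B p clA clB [ABp kp]; apply: contrapT => /not_orP[nA nB].
  pose g (k : option J) := if k is Some i then oexp (f i) else ofnat 1.
  have bg k : box_bound (g k) by case: k => [i|]; [exact: ih|exact: box_bound1].
  have [i nAi] : exists i, ~ der_iter far1 A (g i) p.1.
    apply: contrapT => h; apply: nA; split; first by case: ABp.
    by move=> i _; apply: contrapT => h'; apply: h; exists i.
  have [j nBj] : exists j, ~ der_iter far2 B (g j) p.2.
    apply: contrapT => h; apply: nB; split; first by case: ABp.
    by move=> j _; apply: contrapT => h'; apply: h; exists j.
  have [gij|gij] := ole_total (g i) (g j).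
  + by case: (bg j A B p clA clB (kp j Logic.I)) => // /(der_iter_anti gij).
  + by case: (bg i A B p clA clB (kp i Logic.I)) => // /(der_iter_anti gij).
Qed.

End product.

(** * Scalars, norms and functionals *)

(** Bundled as a ring morphism so that one argument serves real and complex scalars; [c] is
    inspected only where the field itself matters. *)
Definition of_real {R : realType} {c : scalar_kind} : {rmorphism R -> base_field R c} :=
  match c return {rmorphism R -> base_field R c} with
  | RealScalars => idfun
  | ComplexScalars => real_complex R
  end.

Lemma scalar_reD (R : realType) (c : scalar_kind) (a b : base_field R c) :
  scalar_re (a + b) = scalar_re a + scalar_re b.
Proof. by case: c a b => //= a b; rewrite raddfD. Qed.

Lemma scalar_reB (R : realType) (c : scalar_kind) (a b : base_field R c) :
  scalar_re (a - b) = scalar_re a - scalar_re b.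
Proof. by case: c a b => //= a b; rewrite raddfB. Qed.

Lemma scalar_re_realM (R : realType) (c : scalar_kind) r (a : base_field R c) :
  scalar_re (of_real r * a) = r * scalar_re a.
Proof. by case: c a => //= -[a b]; rewrite /= mul0r subr0. Qed.

Lemma of_realK (R : realType) (c : scalar_kind) :
  cancel (@of_real R c) (@scalar_re R c).
Proof. by case: c. Qed.

Lemma scalar_reK (R : realType) (c : scalar_kind) (a : base_field R c) :
  0 <= a -> of_real (scalar_re a) = a.
Proof. by case: c a => //= -[a b]; rewrite lecE /= => /andP[/eqP-> _]. Qed.

Lemma ler_of_real (R : realType) (c : scalar_kind) :
  {mono @of_real R c : r s / r <= s}.
Proof. by case: c => //= r s; rewrite lecE /= eqxx. Qed.

Lemma ltr_of_real (R : realType) (c : scalar_kind) :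
  {mono @of_real R c : r s / r < s}.
Proof. by case: c => //= r s; rewrite ltcE /= eqxx. Qed.

Lemma scalar_re_norm (R : realType) (c : scalar_kind) (a : base_field R c) :
  scalar_re a <= scalar_re `|a|.
Proof.
case: c a => /= a; first exact: ler_norm.
have : `|complex.Re a|%:C%C <= `|a| by exact: normc_ge_Re.
rewrite [X in _ <= X -> _](_ : _ = (complex.Re `|a|)%:C%C); last first.
  by rewrite RRe_real// ger0_real.
by rewrite lecR => /(le_trans (ler_norm _)).
Qed.

Section norms.
Context {R : realType} {c : scalar_kind}.
Local Notation K := (base_field R c).
Implicit Types X Y Z W : normedModType K.

Section rnorm.
Context {X : normedModType K}.
Implicit Types x y : X.

Lemma norm_of_real x : `|x| = of_real (rnorm x).
Proof. by rewrite scalar_reK. Qed.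

Lemma rnorm_ge0 x : 0 <= rnorm x.
Proof. by rewrite -(ler_of_real c) -norm_of_real rmorph0. Qed.

Lemma rnormD x y : rnorm (x + y) <= rnorm x + rnorm y.
Proof. by rewrite -(ler_of_real c) rmorphD -!norm_of_real ler_normD. Qed.

Lemma rnormN x : rnorm (- x) = rnorm x.
Proof. by rewrite /rnorm normrN. Qed.

Lemma rnormB x y : rnorm (x - y) <= rnorm x + rnorm y.
Proof. by rewrite -(rnormN y) rnormD. Qed.

Lemma rnormZ (a : K) x : rnorm (a *: x) = rnorm (a : K^o) * rnorm x.
Proof.
rewrite {1}/rnorm normrZ -[RHS](@of_realK R c) rmorphM -!norm_of_real.
by rewrite /rnorm !scalar_reK.
Qed.

Lemma rnorm0 : rnorm (0 : X) = 0.
Proof. by rewrite -(scale0r 0) rnormZ /rnorm normr0 -(rmorph0 (@of_real R c)) of_realK mul0r. Qed.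

Lemma rnorm_eq0 x : (rnorm x == 0) = (x == 0).
Proof.
apply/eqP/eqP => [x0|->]; last exact: rnorm0.
by apply/eqP; rewrite -normr_eq0 norm_of_real x0 rmorph0.
Qed.

Lemma rnorm_gt0 x : (0 < rnorm x) = (x != 0).
Proof. by rewrite lt_def rnorm_ge0 andbT rnorm_eq0. Qed.

End rnorm.

Lemma rnorm_of_real r : rnorm (of_real r : K^o) = `|r|.
Proof.
have h s : 0 <= s -> rnorm (of_real s : K^o) = s.
  by move=> s0; rewrite /rnorm ger0_norm ?of_realK// -(rmorph0 (@of_real R c)) ler_of_real.
case: (lerP 0 r) => r0; first by rewrite h// ger0_norm.
by rewrite -rnormN -rmorphN h ?ltr0_norm// oppr_ge0 ltW.
Qed.

Lemma rnormM (a b : K) : rnorm (a * b : K^o) = rnorm (a : K^o) * rnorm (b : K^o).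
Proof. exact: (rnormZ a (b : K^o)). Qed.

Lemma rnorm_continuous X : continuous (@rnorm R c X).
Proof.
move=> x; apply/cvgrPdist_le => e e0; apply/nbhs_ballP.
exists (of_real e) => /=; first by rewrite -(rmorph0 (@of_real R c)) ltr_of_real.
move=> y; rewrite -ball_normE /= norm_of_real ltr_of_real => /ltW xy.
rewrite ler_norml; apply/andP; split.
- have := rnormD x (y - x); rewrite addrC subrK -(rnormN (y - x)) opprB; lra.
- have := rnormD y (x - y); rewrite addrC subrK; lra.
Qed.

Lemma operator_ext X Y (A B : operator X Y) : A =1 B -> A = B.
Proof.
case: A B => [f fc] [g gc] /= fg.
have fgE : f = g.
  case: f g {fc gc} fg => [f [[fa] [fs]]] [g [[ga] [gs]]] /= /funext fg.
  by subst g; rewrite (Prop_irrelevance fa ga) (Prop_irrelevance fs gs).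
by subst g; rewrite (Prop_irrelevance fc gc).
Qed.

Lemma operator_bounded X Y (A : operator X Y) :
  exists2 C, 0 < C & forall x, rnorm (A x) <= C * rnorm x.
Proof.
have /linear_bounded_continuous/linear_boundedP := op_continuous (o := A).
move=> /pinfty_ex_gt0[M M0 AM]; exists (scalar_re M).
  by rewrite -(ltr_of_real c) rmorph0 scalar_reK// ltW.
move=> x; have := AM x.
rewrite !norm_of_real -[X in X * _](scalar_reK (ltW M0)) -rmorphM.
by rewrite ler_of_real.
Qed.

Lemma bounded_continuous X Y (f : {linear X -> Y}) C :
  (forall x, rnorm (f x) <= C * rnorm x) -> continuous f.
Proof.
move=> fC; apply/bounded_linear_continuous/linear_boundedP.
near=> M => x; apply: (@le_trans _ _ (of_real C * `|x|)).
  by rewrite !norm_of_real -rmorphM ler_of_real.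
by apply: ler_wpM2r => //; near: M; apply: nbhs_pinfty_ge; rewrite realE
  -(rmorph0 (@of_real R c)) !ler_of_real; exact: le_total.
Unshelve. all: by end_near. Qed.

Definition mk_operator X Y (f : X -> Y) C (fD : forall x y, f (x + y) = f x + f y)
    (fZ : forall a x, f (a *: x) = a *: f x)
    (fC : forall x, rnorm (f x) <= C * rnorm x) : {A : operator X Y | A =1 f}.
Proof.
have flin : linear f by move=> a x y; rewrite fD fZ.
pose F := HB.pack_for {linear X -> Y} f (GRing.isLinear.Build _ _ _ _ f flin).
by exists (Operator (@bounded_continuous X Y F C fC)).
Defined.

(** A single vector of the unit ball witnesses that the dual norm of [f - g] exceeds [eps], so the
    estimates below involve no suprema. *)
Definition apart X (eps : R) (f g : dual X) : Prop :=
  exists2 x, rnorm x <= 1 & eps < rnorm (f x - g x : K^o).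

Lemma dual_ballP X (f : dual X) :
  dual_ball f <-> forall x, rnorm (f x : K^o) <= rnorm x.
Proof.
split=> [|fle]; last first.
  apply: ge_ereal_sup => _ [x x1 <-]; rewrite lee_fin.
  exact: le_trans (fle x) x1.
move=> /ereal_supP fle x; have [->|x0] := eqVneq x 0; first by rewrite linear0 !rnorm0.
have rx0 : 0 < rnorm x by rewrite rnorm_gt0.
pose a : K := of_real (rnorm x)^-1.
have ra : rnorm (a : K^o) = (rnorm x)^-1 by rewrite rnorm_of_real gtr0_norm// invr_gt0.
have : ((rnorm (f (a *: x) : K^o))%:E <= 1)%E.
  by apply: fle; exists (a *: x) => //=; rewrite rnormZ ra mulVf// gt_eqF.
by rewrite linearZ/= lee_fin rnormZ ra ler_pdivrMl// mulr1.
Qed.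

(** The strict inequality is what makes this work: a supremum exceeds [eps] exactly when one of its
    members does, for the diameter and for the dual norm alike. *)
Lemma szlenk_derivationE X eps (S : set (dual X)) :
  szlenk_derivation eps S = @der (wstar X) (apart eps) S.
Proof.
rewrite eqEsubset; split=> f [Sf Vf]; split=> // V nV.
  have /ereal_sup_gt[_ [[g h] [[/= Vg Sg] [Vh Sh]] <-]] := Vf V nV.
  by move=> /ereal_sup_gt[_ [x x1 <-] xgh]; exists g, h; split=> //; exists x.
have [g [h [Vg Sg Vh Sh [x x1 xgh]]]] := Vf V nV.
apply: (@lt_le_trans _ _ (rnorm (g x - h x : K^o))%:E); first by rewrite lte_fin.
apply: le_trans (ereal_sup_ubound _); first last.
  by exists (g, h).
by apply: ereal_sup_ubound; exists x.
Qed.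

Lemma szlenk_iterE X eps (S : set (dual X)) z :
  szlenk_iter eps S z = @der_iter (wstar X) (apart eps) S z.
Proof.
elim: z => [//|z /= -> |J f ih /=]; first exact: szlenk_derivationE.
by congr (_ `&` _); apply: eq_bigcapr => i _; exact: ih.
Qed.

Lemma apart_half X eps (f g h : dual X) :
  apart eps f g -> apart (eps / 2) f h \/ apart (eps / 2) g h.
Proof.
move=> [x x1 xfg]; have [xfh|xfh] := ltP (eps / 2) (rnorm (f x - h x : K^o)).
  by left; exists x.
right; exists x => //; have := rnormB (f x - h x : K^o) (g x - h x).
by rewrite opprB addrA subrK; lra.
Qed.

Lemma eval_continuous X (x : X) : continuous (fun f : wstar X => (f : dual X) x : K^o).
Proof.
move=> f; apply: (@continuous_comp _ _ _
  (fun f : wstar X => ((f : dual X) : X -> K^o) : {ptws X -> K^o})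
  (fun g : {ptws X -> K^o} => g x)).
  exact: initial_continuous.
exact: (@proj_continuous X (fun=> K^o) x).
Qed.

Lemma wstar_cvg X (F : set_system (wstar X)) (f : wstar X) : Filter F ->
  (forall x, (fun g : wstar X => (g : dual X) x : K^o) @ F --> ((f : dual X) x : K^o)) ->
  F --> f.
Proof.
move=> FF Ff V /= [_ [[B oB <-] Bf BV]]; apply: filterS BV _.
have /pointwise_cvgP : forall x, (fun g : X -> K^o => g x) @
    ((fun g : wstar X => (g : dual X) : X -> K^o) @ F) --> ((f : dual X) x : K^o).
  by move=> x; exact: Ff.
apply; exact: open_nbhs_nbhs.
Qed.

Lemma wstar_continuous (T : topologicalType) X (phi : T -> wstar X) :
  (forall x, continuous (fun t => (phi t : dual X) x : K^o)) -> continuous phi.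
Proof. by move=> cphi t; apply: wstar_cvg => x; exact: cphi. Qed.

Lemma wstar_hausdorff X : hausdorff_space (wstar X).
Proof.
move=> f g fg; apply: operator_ext => x; apply: (@norm_hausdorff _ K^o) => A B nA nB.
have [h [Ah Bh]] := fg _ _ (@eval_continuous X x f _ nA) (@eval_continuous X x g _ nB).
by exists ((h : dual X) x).
Qed.

End norms.

(** * The Banach-Alaoglu theorem *)

Lemma of_real_continuous (R : realType) (c : scalar_kind) :
  continuous (of_real : R -> (base_field R c)^o).
Proof.
move=> x; apply/cvgrPdist_lt => e e0; have := ltW e0 => e0'.
have re0 : 0 < scalar_re e by rewrite -(ltr_of_real c) rmorph0 scalar_reK.
near=> y; rewrite -rmorphB norm_of_real rnorm_of_real -(scalar_reK e0') ltr_of_real.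
by near: y; exact: cvgr_dist_lt.
Unshelve. all: by end_near. Qed.

Lemma closed_rnorm_le (R : realType) (c : scalar_kind)
    (X : normedModType (base_field R c)) (r : R) :
  closed [set x : X | rnorm x <= r].
Proof.
have := (continuous_closedP _).1 (@rnorm_continuous R c X) [set s | s <= r].
by apply; exact: closed_le.
Qed.

Lemma compact_scalar_ball (R : realType) (c : scalar_kind) (r : R) :
  compact [set a : (base_field R c)^o | rnorm a <= r].
Proof.
have clr := @closed_rnorm_le R c (base_field R c)^o r.
case: c clr => clr.
  apply: subclosed_compact clr (@segment_compact R (- r) r) _ => a /=.
  by rewrite in_itv /= -ler_norml.
pose K := base_field R ComplexScalars; pose i : K := 'i%C.
(* The complex disc is a closed subset of the image of a compact square under [phi]. *)
pose phi (p : R * R) : K^o := (of_real p.1 : K^o) + i *: (of_real p.2 : K^o).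
have cphi : continuous phi.
  move=> p; apply: cvgD.
    by apply: (continuous_comp (@cvg_fst _ _ _ _ _)); exact: of_real_continuous.
  apply: cvgZl_tmp.
  by apply: (continuous_comp (@cvg_snd _ _ _ _ _)); exact: of_real_continuous.
apply: (subclosed_compact clr (B := phi @` (`[- r, r] `*` `[- r, r]))).
  apply: continuous_compact; first exact: continuous_subspaceT.
  by apply: compact_setX; exact: segment_compact.
move=> [a b] /= abr; exists (a, b) => /=; last exact/esym/complexE.
have rr (z : R[i]) : complex.Re `|z| <= r -> complex.Re z \in `[- r, r].
  rewrite in_itv /= -ler_norml; apply: le_trans.
  rewrite ler_norml; apply/andP; split; last exact: (@scalar_re_norm R ComplexScalars).
  have := @scalar_re_norm R ComplexScalars (- z); rewrite normrN /= => h.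
  by rewrite lerNl; case: z h.
split; first exact: (rr (a +i* b)%C).
(* The imaginary part of a number is the real part of its product with [- i], which has the same
   modulus. *)
apply: (rr (b +i* - a)%C).
suff -> : `|(b +i* - a)%C : R[i]| = `|(a +i* b)%C : R[i]| by exact: abr.
by rewrite !normc_def /= sqrrN addrC.
Qed.

Section banach_alaoglu.
Context {R : realType} {c : scalar_kind}.
Local Notation K := (base_field R c).

(** Along an ultrafilter of the dual ball, the values at [x] stay in a compact ball of scalars of
    radius [rnorm x] and so converge. The pointwise limit inherits linearity and the norm bound. *)
Lemma dual_ball_compact (X : normedModType K) : compact (@dual_ball R c X : set (wstar X)).
Proof.
rewrite compact_ultra => F FU FB.
have ev x : exists a : K^o, rnorm a <= rnorm x /\
    (fun f : wstar X => (f : dual X) x : K^o) @ F --> a.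
  pose e (f : wstar X) : K^o := (f : dual X) x.
  have Fe : F (e @^-1` [set a | rnorm a <= rnorm x]).
    by apply: (@filterS _ F _ (@dual_ball R c X)) => // f /dual_ballP h; exact: (h x).
  have [a [ax clu]] := @compact_scalar_ball R c (rnorm x) (e @ F) _ Fe.
  (* A cluster point of an ultrafilter is a limit: were the complement of the preimage of [V] in
     [F], the values would avoid [V]. *)
  exists a; split=> // V nV; case: (in_ultra_setVsetC (e @^-1` V) FU) => // FnV.
  by have [y [+ Vy]] := clu (~` V) V FnV nV; case.
have [g /all_and2[gle Fg]] := choice ev.
have gD x y : g (x + y) = g x + g y.
  apply: (cvg_unique _ (Fg (x + y))) => //.
  have -> : (fun f : wstar X => (f : dual X) (x + y) : K^o) =
      (fun f : wstar X => ((f : dual X) x : K^o) + ((f : dual X) y : K^o)).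
    by apply: funext => f; rewrite linearD.
  exact: cvgD.
have gZ a x : g (a *: x) = a *: g x.
  apply: (cvg_unique _ (Fg (a *: x))) => //.
  have -> : (fun f : wstar X => (f : dual X) (a *: x) : K^o) =
      (fun f : wstar X => a *: ((f : dual X) x : K^o)).
    by apply: funext => f; rewrite linearZ.
  exact: cvgZl_tmp.
have [|f fg] := @mk_operator R c X K^o g 1 gD gZ.
  by move=> x; rewrite mul1r.
exists f; split; first by apply/dual_ballP => x; rewrite fg.
by apply: wstar_cvg => x; rewrite fg.
Qed.

End banach_alaoglu.

(** * The Hahn-Banach theorem *)

Section hahn_banach.
Context {R : realType} {c : scalar_kind}.
Local Notation K := (base_field R c).
Implicit Types X Y Z : normedModType K.

(* Graphs of real-linear functionals bounded by the norm, defined on real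
   subspaces; functionality follows from the bound at [0]. *)
Record dominated X (G : set (X * R)) : Prop := {
  dom0 : G (0, 0);
  domD : forall p q, G p -> G q -> G (p.1 + q.1, p.2 + q.2);
  domZ : forall t p, G p -> G ((of_real t : K) *: p.1, t * p.2);
  dom_le : forall p, G p -> p.2 <= rnorm p.1
}.

(** The value at [x0] must lie above every [q.2 - rnorm (q.1 - x0)] and below every
    [rnorm (q.1 + x0) - q.2]. The triangle inequality makes these constraints compatible, and
    scaling by the inverse of [t] or of [- t] reduces any multiple of [x0] to these two cases. *)
Lemma dominated_extend X (G : set (X * R)) x0 : dominated G ->
  exists a, dominated [set p | exists q t,
    G q /\ p = (q.1 + (of_real t : K) *: x0, q.2 + t * a)].
Proof.
move=> dG; pose E := [set q.2 - rnorm (q.1 - x0) | q in G].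
have E_ub q : G q -> ubound E (rnorm (q.1 + x0) - q.2).
  move=> Gq _ [p Gp <-]; have /= := dom_le dG (domD dG Gp Gq).
  have := rnormD (p.1 - x0) (q.1 + x0); rewrite addrACA addNr addr0; lra.
have supE : has_sup E.
  split; first by exists (0 - rnorm (0 - x0)); exists (0, 0) => //; exact: dom0.
  by exists (rnorm (0 + x0) - 0); exact: (E_ub _ (dom0 dG)).
pose a := sup E.
have a_ge q : G q -> q.2 - rnorm (q.1 - x0) <= a.
  by move=> Gq; apply: sup_upper_bound => //; exists q.
have a_le q : G q -> a <= rnorm (q.1 + x0) - q.2.
  by move=> Gq; apply: ge_sup; [case: supE|exact: E_ub].
exists a; split.
- by exists (0, 0), 0; split; [exact: dom0|rewrite /= rmorph0 scale0r mul0r !addr0].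
- move=> _ _ [p [s [Gp ->]]] [q [t [Gq ->]]].
  exists (p.1 + q.1, p.2 + q.2), (s + t); split; first exact: domD.
  congr (_, _); rewrite /=; last by rewrite mulrDl addrACA.
  by rewrite rmorphD scalerDl addrACA.
- move=> s _ [p [t [Gp ->]]].
  exists ((of_real s : K) *: p.1, s * p.2), (s * t); split; first exact: domZ.
  congr (_, _); rewrite /=; last by rewrite mulrDr mulrA.
  by rewrite rmorphM scalerDr scalerA.
move=> _ [p [t [Gp ->]]] /=.
have scaleV s (x : X) : 0 < s -> rnorm ((of_real s^-1 : K) *: x) = s^-1 * rnorm x.
  by move=> s0; rewrite rnormZ rnorm_of_real gtr0_norm ?invr_gt0.
have [t0|t0|->] := ltgtP t 0.
- have s0 : 0 < - t by lra.
  have := a_ge _ (domZ dG (- t)^-1 Gp); rewrite /=.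
  have -> : (of_real (- t)^-1 : K) *: p.1 - x0 =
      (of_real (- t)^-1 : K) *: (p.1 + (of_real t : K) *: x0).
    by rewrite scalerDr scalerA -rmorphM invrN mulNr mulVf ?lt_eqF// rmorphN1 scaleN1r.
  by rewrite scaleV// -mulrBr -(ler_pM2l s0) mulrA divff ?gt_eqF// mul1r; lra.
- have := a_le _ (domZ dG t^-1 Gp); rewrite /=.
  have -> : (of_real t^-1 : K) *: p.1 + x0 =
      (of_real t^-1 : K) *: (p.1 + (of_real t : K) *: x0).
    by rewrite scalerDr scalerA -rmorphM mulVf ?gt_eqF// rmorph1 scale1r.
  by rewrite scaleV// -mulrBr -(ler_pM2l t0) mulrA divff ?gt_eqF// mul1r; lra.
- by rewrite rmorph0 scale0r mul0r !addr0; exact: (dom_le dG Gp).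
Qed.

Lemma dominated_max X (G0 : set (X * R)) : dominated G0 ->
  exists G, [/\ dominated G, G0 `<=` G & forall x, exists r, G (x, r)].
Proof.
move=> dG0; pose P (A : set (X * R)) := dominated (G0 `|` A).
(* Zorn's lemma also asks about the empty chain, whose union is empty. Hence [P] carries [G0] along,
   and [F'] adds the empty set to the chain. *)
have [|A [PA Amax]] := @Zorn_bigcup _ P.
  move=> F FP Ftot; pose F' := F `|` [set set0].
  have F'P A : F' A -> P A by move=> [/FP//|->]; rewrite /P setU0.
  have F'tot A B : F' A -> F' B -> A `<=` B \/ B `<=` A.
    move=> [FA|->]; last by left.
    by move=> [FB|->]; [exact: Ftot|right].
  have inF' p : (G0 `|` \bigcup_(A in F) A) p -> exists2 A, F' A & (G0 `|` A) p.
    move=> [Gp|[A FA Ap]]; last by exists A; [left|right].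
    by exists set0; [right|left].
  have subF' A : F' A -> G0 `|` A `<=` G0 `|` \bigcup_(A in F) A.
    move=> [FA|->]; last by rewrite setU0; left.
    by apply: setUS => p Ap; exists A.
  split.
  - by left; exact: dom0.
  - move=> p q /inF'[A FA Ap] /inF'[B FB Bq].
    have [AB|BA] := F'tot A B FA FB.
      by apply: (subF' B FB); apply: (domD (F'P B FB)) => //; exact: setUS Ap.
    by apply: (subF' A FA); apply: (domD (F'P A FA)) => //; exact: setUS Bq.
  - by move=> t p /inF'[A FA Ap]; apply: (subF' A FA); exact: (domZ (F'P A FA)).
  - by move=> p /inF'[A FA Ap]; exact: (dom_le (F'P A FA)).
exists (G0 `|` A); split => // x.
have [a dG] := dominated_extend x PA; set G := [set p | _] in dG.
have AG : G0 `|` A `<=` G.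
  move=> [v r] Gvr; exists (v, r), 0.
  by rewrite /= rmorph0 scale0r mul0r !addr0.
exists a; apply: contrapT => nxa; apply: (Amax G).
  split; first by move=> p Ap; apply: AG; right.
  move=> GA; apply: nxa; right; apply: GA; exists (0, 0), 1; split; first exact: dom0.
  by rewrite /= rmorph1 scale1r mul1r !add0r.
by rewrite /P setUidr// => p G0p; apply: AG; left.
Qed.

End hahn_banach.

(** Over the complex numbers, a real-linear [phi] is the real part of the functional sending [x] to
    [phi x - i phi (i x)]. *)
Lemma complexify (R : realType) (c : scalar_kind) (X : normedModType (base_field R c))
    (phi : X -> R) : {morph phi : x y / x + y} ->
  (forall t x, phi ((of_real t : base_field R c) *: x) = t * phi x) ->
  exists h : X -> base_field R c,
    [/\ forall x y, h (x + y) = h x + h y,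
        forall a x, h (a *: x) = a * h x & forall x, scalar_re (h x) = phi x].
Proof.
case: c X phi => X phi phiD phiZ; first by exists phi.
have phiN x : phi (- x) = - phi x.
  by rewrite -scaleN1r -(rmorph1 (@of_real R ComplexScalars)) -rmorphN phiZ mulN1r.
pose i : base_field R ComplexScalars := 'i%C.
exists (fun x => (phi x +i* - phi (i *: x))%C); split => //.
  by move=> x y; rewrite scalerDr !phiD opprD.
move=> [a b] x.
have aE : (a +i* b)%C *: x = (of_real a : base_field R ComplexScalars) *: x +
    (of_real b : base_field R ComplexScalars) *: (i *: x).
  by rewrite scalerA -scalerDl; congr (_ *: _); rewrite [LHS]complexE mulrC.
have iE : i *: ((a +i* b)%C *: x) = (of_real a : base_field R ComplexScalars) *: (i *: x) -
    (of_real b : base_field R ComplexScalars) *: x.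
  rewrite !scalerA -scaleNr -scalerDl; congr (_ *: _).
  apply/eqP; rewrite eq_complex /=; apply/andP; split; apply/eqP; lra.
rewrite iE aE !phiD phiN !phiZ; apply/eqP; rewrite eq_complex /=.
by apply/andP; split; apply/eqP; lra.
Qed.

Section hahn_banach_extension.
Context {R : realType} {c : scalar_kind}.
Local Notation K := (base_field R c).
Implicit Types X Y Z : normedModType K.

(** Multiplying [x] by a scalar [u] of modulus one makes [h (u *: x)] equal to the modulus of [h x],
    so the bound on real parts applies. *)
Lemma rnorm_le_re X (h : X -> K) : (forall a x, h (a *: x) = a * h x) ->
  (forall x, scalar_re (h x) <= rnorm x) -> forall x, rnorm (h x : K^o) <= rnorm x.
Proof.
move=> hZ hle x; have [hx0|hx0] := eqVneq (h x) 0.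
  by rewrite hx0 (rnorm0 (X := K^o)) rnorm_ge0.
have nhx : rnorm (h x : K^o) != 0 by rewrite (rnorm_eq0 (h x : K^o)).
pose u : K := of_real (rnorm (h x : K^o)) / h x.
have := hle (u *: x); rewrite hZ mulfVK// of_realK rnormZ.
suff -> : rnorm (u : K^o) = 1 by rewrite mul1r.
have : rnorm (u * h x : K^o) = rnorm (h x : K^o).
  by rewrite mulfVK// rnorm_of_real ger0_norm// rnorm_ge0.
by rewrite rnormM => /(canRL (mulfK nhx)) ->; rewrite divff.
Qed.

Lemma re_eq0 X (h : X -> K) : (forall a x, h (a *: x) = a * h x) ->
  (forall x, scalar_re (h x) = 0) -> forall x, h x = 0.
Proof.
move=> hZ h0 x; apply: contra_eq (h0 ((h x)^-1 *: x)) => hx0.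
by rewrite hZ mulVf// -(rmorph1 (@of_real R c)) of_realK oner_eq0.
Qed.

(** The real part of [g], transported to the range of [j], is dominated because [j] is isometric. A
    maximal dominated extension is the graph of a real-linear functional on [Z]; its
    complexification is bounded by [rnorm_le_re] and extends [g] because a linear functional with
    zero real part vanishes. *)
Lemma hahn_banach Y Z (j : operator Y Z) (g : dual Y) :
  isometric_embedding j -> dual_ball g ->
  exists h : dual Z, dual_ball h /\ forall y, h (j y) = g y.
Proof.
move=> jiso /dual_ballP g1.
pose G0 := [set (j y, scalar_re (g y : K)) | y in [set: Y]].
have dG0 : dominated G0.
  split.
  - by exists 0 => //; rewrite !linear0 -(rmorph0 (@of_real R c)) of_realK.
  - move=> _ _ [x _ <-] [y _ <-]; exists (x + y) => //.
    by rewrite !linearD scalar_reD.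
  - move=> t _ [x _ <-]; exists ((of_real t : K) *: x) => //.
    by rewrite !linearZ /= scalar_re_realM.
  - move=> _ [x _ <-] /=; apply: le_trans (scalar_re_norm _) _.
    by rewrite /rnorm jiso; exact: g1.
have [G [dG G0G Gtot]] := dominated_max dG0.
have Gfun x r s : G (x, r) -> G (x, s) -> r = s.
  suff le_rs r' s' : G (x, r') -> G (x, s') -> r' <= s'.
    by move=> Gr Gs; apply/eqP; rewrite eq_le !le_rs.
  move=> Gr /(domZ dG (- 1)) /(domD dG Gr) /(dom_le dG) /=.
  by rewrite rmorphN rmorph1 scaleN1r subrr rnorm0 mulN1r subr_le0.
have [phi Gphi] := choice Gtot.
have phiD : {morph phi : x y / x + y}.
  by move=> x y; apply: (Gfun (x + y)) => //; exact: (domD dG (Gphi x) (Gphi y)).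
have phiZ t x : phi ((of_real t : K) *: x) = t * phi x.
  by apply: (Gfun ((of_real t : K) *: x)) => //; exact: (domZ dG t (Gphi x)).
have [h [hD hZ hphi]] := complexify phiD phiZ.
have hle : forall x, rnorm (h x : K^o) <= rnorm x.
  by apply: rnorm_le_re => // x; rewrite hphi; exact: (dom_le dG (Gphi x)).
have [|H Hh] := @mk_operator R c Z K^o h 1 hD hZ.
  by move=> x; rewrite mul1r.
exists H; split; first by apply/dual_ballP => x; rewrite Hh.
move=> y; rewrite Hh; apply/eqP; rewrite -subr_eq0; apply/eqP.
pose gK x : K := g x.
have gKZ a x : gK (a *: x) = a * gK x by rewrite /gK linearZ.
apply: (@re_eq0 Y (fun y => h (j y) - gK y)) => [a x|x].
  by rewrite gKZ linearZ hZ mulrBr.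
rewrite scalar_reB hphi; apply/eqP; rewrite subr_eq0; apply/eqP.
by apply: (Gfun (j x)) => //; apply: G0G; exists x.
Qed.

End hahn_banach_extension.

(** * Growth of the Szlenk indices *)

Lemma at_right0P (R : realType) (V : set R) :
  (0 : R)^'+ V <-> exists2 d : R, 0 < d & forall x, 0 < x < d -> V x.
Proof.
split.
  move=> /nbhs_ballP[d /= d0 dV]; exists d => // x /andP[x0 xd].
  by apply: dV => //; rewrite /ball /= sub0r normrN gtr0_norm.
move=> [d d0 dV]; near=> x; apply: dV; apply/andP; split.
  by near: x; exact: nbhs_right_gt.
by near: x; exact: nbhs_right_lt.
Unshelve. all: by end_near. Qed.

(** As every nonempty set of ordinals has a least element, [None] means that [P] is empty; otherwise
    upward closure turns a comparison with the least element into membership. *)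
Lemma oleast_le (P : set ord) b :
  (forall a a', ole a a' -> P a -> P a') -> xole (oleast P) (Some b) <-> P b.
Proof.
move=> Pup; rewrite /oleast; case: pselect => [h|nh]; split=> //=.
- by move=> hb; apply: (Pup _ _ hb); case: (projT2 (cid h)).
- by move=> Pb; case: (projT2 (cid h)) => _; apply.
- by move=> Pb; apply: nh; apply: is_oleast_exists; exists b.
Qed.

Section growth.
Context {R : realType} {c : scalar_kind}.
Implicit Types X : normedModType (base_field R c).

Lemma Sz_le X (S : set (dual X)) k : xole (Sz S) (Some k) <->
  forall eps : R, 0 < eps -> szlenk_iter eps S k = set0.
Proof.
have up eps a a' : ole a a' -> szlenk_iter eps S a = set0 -> szlenk_iter eps S a' = set0.
  by move=> aa' a0; rewrite -subset0 -a0; exact: szlenk_iter_subset.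
rewrite /Sz /xosup; case: asboolP => [[[e e0] /= eN]|nN]; split=> //=.
- by move=> /(_ e e0) /(oleast_le _ (up e)); rewrite -/(Sz_eps S e) eN.
- move=> h e e0; apply/(oleast_le _ (up e)); rewrite -/(Sz_eps S e).
  have := h (exist _ e e0); rewrite /=; case E : (Sz_eps S e) => [//|].
  by case: nN; exists (exist _ e e0).
- move=> h [e e0] /=; have /(oleast_le _ (up e)) := h e e0.
  by rewrite -/(Sz_eps S e); case: (Sz_eps S e).
Qed.

Definition szlenk_index xi X (S : set (dual X)) (eps : R) : \bar R :=
  xord_ereal R (Sz_xi xi S eps).

Lemma Sz_xi_le xi X (S : set (dual X)) (eps : R) n :
  xole (Sz_xi xi S eps) (Some (ofnat n)) <->
  szlenk_iter eps S (omul (oexp xi) (ofnat n)) = set0.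
Proof.
apply: (@oleast_le [set b | szlenk_iter eps S (omul (oexp xi) b) = set0]).
move=> a b ab /=; rewrite !szlenk_iterE => a0.
by rewrite -subset0 -a0; exact: (@der_iter_omul (wstar X) _ _ _ _ _ ab).
Qed.

Lemma szlenk_index_le xi X (S : set (dual X)) (eps : R) n :
  szlenk_iter eps S (omul (oexp xi) (ofnat n)) = set0 ->
  (szlenk_index xi S eps <= n%:R%:E)%E.
Proof. by move=> /Sz_xi_le Sn; apply: ereal_inf_lbound; exists n. Qed.

Lemma szlenk_index_lt xi X (S : set (dual X)) (eps : R) x : (szlenk_index xi S eps < x)%E ->
  exists2 n, (n%:R%:E < x)%E & szlenk_iter eps S (omul (oexp xi) (ofnat n)) = set0.
Proof.
by move=> /ereal_inf_lt[_ [n /Sz_xi_le Sn <-] nx]; exists n.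
Qed.

(** Zero derivations leave [S] itself. Logarithms of indices are therefore nonnegative. *)
Lemma szlenk_index_ge1 xi X (S : set (dual X)) (eps : R) : S !=set0 ->
  (1 <= szlenk_index xi S eps)%E.
Proof.
move=> [x Sx]; rewrite leNgt; apply/negP => /szlenk_index_lt[[|n]].
  by move=> _ S0; have : set0 x by rewrite -S0.
by rewrite lte_fin ltNge -[1]/(1%:R) ler_nat.
Qed.

Lemma limf_esup_szlenk_index_ge0 xi X (S : set (dual X)) : S !=set0 ->
  (0 <= limf_esup (fun eps => lne (szlenk_index xi S eps) * (`|ln eps|^-1)%:E) 0^'+)%E.
Proof.
move=> S0; apply: limf_esup_ge0 => [F0|x].
  by have /filter_ex[] := F0.
by rewrite mule_ge0 ?lne_ge0 ?szlenk_index_ge1// lee_fin invr_ge0.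
Qed.

Lemma szlenk_index_lt_expR xi X (S : set (dual X)) (eps l r : R) : 0 < l -> S !=set0 ->
  (lne (szlenk_index xi S eps) * (l^-1)%:E < r%:E)%E ->
  (szlenk_index xi S eps < (expR (r * l))%:E)%E.
Proof.
move=> l0 /(szlenk_index_ge1 xi eps); case: (szlenk_index xi S eps) => [s|_|//].
- rewrite lee_fin => s1; have s0 : 0 < s by exact: lt_le_trans s1.
  rewrite lne_EFin// -EFinM !lte_fin ltr_pdivrMr// => sl.
  by rewrite -[X in X < _](lnK s0) ltr_expR.
(* An infinite index would make the left-hand side of the hypothesis infinite, as [l] is
   positive. *)
- by rewrite /= mulyr gtr0_sg ?invr_gt0// mul1e.
Qed.

(* With [l = ln (C / eps)], [szlenk_index S1 (eps / C)] and [szlenk_index S2 (eps / C)] are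
   eventually less than [exp (r l)], and [(ln 2 + r l) / |ln eps|] tends to
   [r]. *)
Lemma p_set_le xi C X X1 X2 (S : set (dual X)) (S1 : set (dual X1)) (S2 : set (dual X2)) :
  1 <= C -> S !=set0 -> S1 !=set0 -> S2 !=set0 ->
  (forall eps, 0 < eps ->
     szlenk_iter (eps / C) S1 (oexp (OSucc xi)) = set0 ->
     szlenk_iter (eps / C) S2 (oexp (OSucc xi)) = set0 ->
     szlenk_iter eps S (oexp (OSucc xi)) = set0) ->
  (forall eps m n, 0 < eps ->
     szlenk_iter (eps / C) S1 (omul (oexp xi) (ofnat m)) = set0 ->
     szlenk_iter (eps / C) S2 (omul (oexp xi) (ofnat n)) = set0 ->
     szlenk_iter eps S (omul (oexp xi) (ofnat (m + n))) = set0) ->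
  (p_set xi S <= maxe (p_set xi S1) (p_set xi S2))%E.
Proof.
move=> C1 S0 S10 S20 hSz hindex; have C0 : 0 < C by exact: lt_le_trans C1.
rewrite /p_set; case: (asboolP (xole (Sz S1) _)) => [/Sz_le z1|_]; last first.
  by rewrite le_max leey.
case: (asboolP (xole (Sz S2) _)) => [/Sz_le z2|_]; last first.
  by rewrite le_max leey orbT.
rewrite asboolT; last first.
  apply/Sz_le => e e0; apply: hSz => //.
    by apply: z1; exact: divr_gt0.
  by apply: z2; exact: divr_gt0.
pose f Y (T : set (dual Y)) (e : R) := (lne (szlenk_index xi T e) * (`|ln e|^-1)%:E)%E.
rewrite -/(f X S) -/(f X1 S1) -/(f X2 S2).
set L := maxe _ _; have L0 : (0 <= L)%E by rewrite le_max limf_esup_szlenk_index_ge0.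
have [->|Lfin] := eqVneq L +oo%E; first exact: leey.
have LM : L = (fine L)%:E by rewrite fineK// ge0_fin_numE// ltey.
set M := fine L in LM; have M0 : 0 <= M by rewrite -lee_fin -LM.
apply/lee_addgt0Pr => e e0; rewrite LM -EFinD.
(* The other half of [e] is kept to absorb the additive constant [ln 2 + r * ln C]. *)
pose r := M + e / 2; have r0 : 0 < r by rewrite /r; lra.
have evr Y (T : set (dual Y)) : (limf_esup (f Y T) 0^'+ <= L)%E ->
    exists2 d : R, 0 < d & forall x, 0 < x < d -> (f Y T x < r%:E)%E.
  move=> fL; have /ereal_inf_lt[_ [V /at_right0P[d d0 dV] <-] Vr] :
      (limf_esup (f Y T) 0^'+ < r%:E)%E.
    by apply: le_lt_trans fL _; rewrite LM lte_fin /r; lra.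
  exists d => // x xd; apply: le_lt_trans Vr.
  by apply: ereal_sup_ubound; exists x => //; exact: dV.
have [d1 d10 fd1] : exists2 d : R, 0 < d & forall x, 0 < x < d -> (f X1 S1 x < r%:E)%E.
  by apply: evr; rewrite le_max lexx.
have [d2 d20 fd2] : exists2 d : R, 0 < d & forall x, 0 < x < d -> (f X2 S2 x < r%:E)%E.
  by apply: evr; rewrite le_max lexx orbT.
apply: le_trans (ereal_inf_lbound _) _.
  exists [set x | (f X S x <= (M + e)%:E)%E]; last by [].
  near=> x.
  have x0 : 0 < x by near: x; exact: nbhs_right_gt.
  have x1 : x < 1 by near: x; exact: nbhs_right_lt.
  have xC0 : 0 < x / C by exact: divr_gt0.
  have lnx : ln x < 0 by rewrite ln_lt0// x0 x1.
  have lnC : 0 <= ln C by exact: ln_ge0.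
  have lnxC : ln (x / C) = ln x - ln C by rewrite ln_div.
  pose l := ln C - ln x; have l0 : 0 < l by rewrite /l; lra.
  have absl : `|ln (x / C)| = l by rewrite lnxC ltr0_norm ?opprB// /l; lra.
  have [n1 n1E Sn1] : exists2 n, (n%:R%:E < (expR (r * l))%:E)%E &
      szlenk_iter (x / C) S1 (omul (oexp xi) (ofnat n)) = set0.
    apply: szlenk_index_lt; apply: szlenk_index_lt_expR => //; rewrite -absl; apply: fd1.
    rewrite xC0 ltr_pdivrMr//; near: x; apply: nbhs_right_lt; exact: mulr_gt0.
  have [n2 n2E Sn2] : exists2 n, (n%:R%:E < (expR (r * l))%:E)%E &
      szlenk_iter (x / C) S2 (omul (oexp xi) (ofnat n)) = set0.
    apply: szlenk_index_lt; apply: szlenk_index_lt_expR => //; rewrite -absl; apply: fd2.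
    rewrite xC0 ltr_pdivrMr//; near: x; apply: nbhs_right_lt; exact: mulr_gt0.
  have := szlenk_index_le (hindex x n1 n2 x0 Sn1 Sn2); have := szlenk_index_ge1 xi x S0.
  rewrite /= /f; case: (szlenk_index xi S x) => [s|//|//]; rewrite !lee_fin => s1 sn.
  have s0 : 0 < s by exact: lt_le_trans s1.
  have s2E : s <= 2 * expR (r * l).
    by move: n1E n2E sn; rewrite !lte_fin natrD; lra.
  rewrite lne_EFin// -EFinM lee_fin ltr0_norm// ler_pdivrMr; last by lra.
  have lns : ln s <= ln 2 + r * l.
    by rewrite -[r * l]expRK -lnM ?posrE ?expR_gt0// ler_ln ?posrE ?mulr_gt0 ?expR_gt0.
  apply: le_trans lns _.
  (* For such [x] the constant [ln 2 + r * ln C] is at most [e / 2] times the absolute value of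
     [ln x]. *)
  have : ln x <= - ((ln 2 + r * ln C) * (2 / e)).
    near: x; move: (- _) => A.
    by have /cvgrNyPle := @lnNy R; apply.
  move: (ln x) (ln C) @l {l0 absl n1E n2E s2E lnxC lnx lnC} => lx lC /= hl.
  have := ler_wpM2l (ltW e0) hl; rewrite mulrN mulrCA (mulrCA e) divff ?gt_eqF//.
  rewrite /r; nra.
by apply: ge_ereal_sup => _ [x fx <-].
Unshelve. all: by end_near. Qed.

End growth.

(** * Szlenk derivations of the sets [A^* B_{Y^*}] *)

Section operators.
Context {R : realType} {c : scalar_kind}.
Local Notation K := (base_field R c).
Implicit Types W X Y Z : normedModType K.

Definition dual_image X Y (A : operator X Y) : set (dual X) :=
  adjoint A @` @dual_ball R c Y.

Lemma adjoint_continuous X Y (A : operator X Y) :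
  continuous (adjoint A : wstar Y -> wstar X).
Proof. by apply: wstar_continuous => x; exact: eval_continuous. Qed.

Lemma dual_image_compact X Y (A : operator X Y) :
  compact (dual_image A : set (wstar X)).
Proof.
apply: (@continuous_compact (wstar Y) (wstar X) (adjoint A)).
  exact/continuous_subspaceT/adjoint_continuous.
exact: dual_ball_compact.
Qed.

Lemma dual_image_closed X Y (A : operator X Y) :
  closed (dual_image A : set (wstar X)).
Proof. exact: (compact_closed (@wstar_hausdorff _ _ X) (@dual_image_compact _ _ A)). Qed.

Lemma dual_image_neq0 X Y (A : operator X Y) : dual_image A !=set0.
Proof.
have [||x|Z0 Z0E] := @mk_operator R c Y K^o (fun=> 0) 0.
- by move=> x y; rewrite addr0.
- by move=> a x; rewrite scaler0.
- by rewrite mul0r rnorm0.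
exists (adjoint A Z0), Z0 => //; apply/dual_ballP => y.
by rewrite Z0E rnorm0 rnorm_ge0.
Qed.

Lemma rnorm_dualZ X (f g : dual X) (a : K) x :
  rnorm (f (a *: x) - g (a *: x) : K^o) = rnorm (a : K^o) * rnorm (f x - g x : K^o).
Proof.
have dualZ (h : dual X) : h (a *: x) = a *: (h x : K^o) by rewrite linearZ.
by rewrite -rnormZ scalerBr !dualZ.
Qed.

Lemma apart_adjoint W X (D : operator W X) (d eps : R) (f g : dual X) : 0 < d ->
  (forall w, rnorm (D w) <= d * rnorm w) ->
  apart eps (adjoint D f) (adjoint D g) -> apart (eps / d) f g.
Proof.
move=> d0 Dd [w w1 fgw]; have d'0 : 0 < d^-1 by rewrite invr_gt0.
exists ((of_real d^-1 : K) *: D w).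
  rewrite rnormZ rnorm_of_real gtr0_norm// ler_pdivrMl// mulr1.
  by apply: le_trans (Dd w) _; rewrite ler_piMr// ltW.
rewrite rnorm_dualZ rnorm_of_real gtr0_norm// mulrC.
by rewrite ltr_pM2l.
Qed.

(** The factor 2 is the cost of comparing with a single limit point, through [apart_half]; the
    factor [d] is the norm bound of [D], through [apart_adjoint]. *)
Lemma szlenk_adjoint W X (D : operator W X) (d eps : R) (S : set (dual X)) z :
  0 < d -> (forall w, rnorm (D w) <= d * rnorm w) ->
  closed (S : set (wstar X)) -> compact (S : set (wstar X)) ->
  szlenk_iter eps (adjoint D @` S) z `<=`
    adjoint D @` szlenk_iter (eps / (2 * d)) S z.
Proof.
move=> d0 Dd clS cS; rewrite !szlenk_iterE.
apply: (@der_iter_image (wstar X) (wstar W) _ _ (apart (eps / 2)) (adjoint D)) => //.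
- exact: adjoint_continuous.
- exact: wstar_hausdorff.
- exact: apart_half.
- by move=> f g; rewrite invfM mulrA; exact: apart_adjoint.
Qed.

Lemma szlenk_subset X eps (S S' : set (dual X)) z : S `<=` S' ->
  szlenk_iter eps S z `<=` szlenk_iter eps S' z.
Proof. by move=> SS'; rewrite !szlenk_iterE; exact: (@der_iter_mono (wstar X)). Qed.

Lemma szlenk_iter_omul X eps (S : set (dual X)) k m n : (m <= n)%N ->
  szlenk_iter eps S (omul k (ofnat n)) `<=` szlenk_iter eps S (omul k (ofnat m)).
Proof.
by move=> mn; rewrite !szlenk_iterE; exact: (@der_iter_omul (wstar X) _ _ _ _ _ (ole_ofnat mn)).
Qed.

Lemma p_op_comp_le xi (W X Y Z : normedModType K) (A : operator Y Z) (B : operator X Y)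
    (C : operator W X) : (p_op xi (op_comp A (op_comp B C)) <= p_op xi B)%E.
Proof.
have [a a0 Aa] := operator_bounded A; have [b b0 Cb] := operator_bounded C.
(* The bound [a] of [A] is moved onto [C], so that [h] composed with [A] can be divided by [a] to
   land in the dual ball of [Y]. *)
have [|||D DE] := @mk_operator R c W X (fun w => (of_real a : K) *: C w) (a * b).
- by move=> x y; rewrite linearD scalerDr.
- by move=> t x; rewrite linearZ !scalerA mulrC.
- move=> x; rewrite rnormZ rnorm_of_real gtr0_norm// -mulrA.
  by rewrite ler_pM2l.
have sub : dual_image (op_comp A (op_comp B C)) `<=` adjoint D @` dual_image B.
  move=> _ [h /dual_ballP h1 <-].
  have gle y : rnorm ((of_real a^-1 : K) *: (h (A y) : K^o)) <= rnorm y.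
    rewrite rnormZ rnorm_of_real gtr0_norm ?invr_gt0// ler_pdivrMl//.
    exact: le_trans (h1 _) (Aa y).
  have [|||g gE] := @mk_operator R c Y K^o (fun y => (of_real a^-1 : K) *: (h (A y) : K^o)) 1.
  - by move=> x y; rewrite !linearD.
  - by move=> t x; rewrite !linearZ /= !scalerA mulrC.
  - by move=> x; rewrite mul1r; exact: gle.
  exists (adjoint B g).
    by exists g => //; apply/dual_ballP => y; rewrite gE; exact: gle.
  apply: operator_ext => w /=; rewrite DE !linearZ /= gE scalerA -rmorphM mulfV ?gt_eqF//.
  by rewrite rmorph1 scale1r.
(* The maximum with 1 is there because [p_set_le] asks for a constant at least 1. *)
pose d := Num.max (a * b) 1.
have d0 : 0 < d by rewrite lt_max ltr01 orbT.
have Dd w : rnorm (D w) <= d * rnorm w.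
  rewrite DE rnormZ rnorm_of_real gtr0_norm// (le_trans (ler_wpM2l (ltW a0) (Cb w)))//.
  by rewrite mulrA ler_wpM2r ?rnorm_ge0// le_max lexx.
have d1 : 1 <= 2 * d.
  by rewrite mulr_ege1 ?ler1n// le_max lexx orbT.
have empty eps z : szlenk_iter (eps / (2 * d)) (dual_image B) z = set0 ->
    szlenk_iter eps (dual_image (op_comp A (op_comp B C))) z = set0.
  move=> Bz; rewrite -subset0 => f /(szlenk_subset sub).
  move=> /(szlenk_adjoint d0 Dd (@dual_image_closed _ _ B) (@dual_image_compact _ _ B)).
  by rewrite Bz image_set0.
(* The two-set comparison is applied with the same set twice. *)
rewrite -[leRHS]maxxx; apply: (p_set_le d1); try exact: dual_image_neq0.
- by move=> e e0 Be _; exact: empty.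
- move=> e m n e0 Bm _; apply: empty; rewrite -subset0 -Bm.
  by apply: szlenk_iter_omul; exact: leq_addr.
Qed.

Lemma p_op_add_le xi X Y (A B : operator X Y) :
  (p_op xi (op_add A B) <= maxe (p_op xi A) (p_op xi B))%E.
Proof.
pose phi (p : wstar X * wstar X) : wstar X := op_add (p.1 : dual X) (p.2 : dual X).
have cphi : continuous phi.
  apply: wstar_continuous => x p.
  apply: (@cvgD _ K^o).
    exact: (continuous_comp (@cvg_fst _ _ _ _ _) (@eval_continuous _ _ _ x _)).
  exact: (continuous_comp (@cvg_snd _ _ _ _ _) (@eval_continuous _ _ _ x _)).
have sub : dual_image (op_add A B) `<=` phi @` (dual_image A `*` dual_image B).
  move=> _ [h h1 <-]; exists (adjoint A h, adjoint B h).
    by split; exists h.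
  by apply: operator_ext => x /=; rewrite linearD.
pose far (eps : R) : wstar X -> wstar X -> Prop := @apart R c X eps.
pose KA : set (wstar X) := dual_image A; pose KB : set (wstar X) := dual_image B.
pose prod_iter (eps : R) z := der_iter (prod_far (far eps) (far eps)) (KA `*` KB) z.
(* One halving of [eps] comes from passing to the image under addition, the other from sharing the
   distance between the two summands. *)
have empty eps z : prod_iter (eps / 4) z = set0 ->
    szlenk_iter eps (dual_image (op_add A B)) z = set0.
  move=> Pz; rewrite -subset0 => f /(szlenk_subset sub); rewrite szlenk_iterE.
  move=> /(@der_iter_image _ (wstar X) (prod_far (far (eps / 4)) (far (eps / 4)))
    _ (far (eps / 2)) phi cphi).
  rewrite -/(prod_iter _ _) Pz image_set0; apply.
  - exact: wstar_hausdorff.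
  - exact: apart_half.
  - move=> p q [x x1 pq].
    have [xp|xp] := ltP (eps / 4) (rnorm ((p.1 : dual X) x - (q.1 : dual X) x : K^o)).
      by left; exists x.
    right; exists x => //.
    have := rnormD ((p.1 : dual X) x - (q.1 : dual X) x : K^o)
      ((p.2 : dual X) x - (q.2 : dual X) x).
    rewrite addrACA -opprD; move: pq xp; rewrite /phi /=; lra.
  - by apply: closed_setX; exact: dual_image_closed.
  - by apply: compact_setX; exact: dual_image_compact.
have clA := @dual_image_closed _ _ A; have clB := @dual_image_closed _ _ B.
apply: (@p_set_le _ _ _ 4); try exact: dual_image_neq0; first by rewrite ler1n.
- move=> e e0; rewrite 2!szlenk_iterE => A0 B0; apply: empty; rewrite -subset0 => p.
  by move=> /(box_bound_oexp clA clB) []; rewrite ?A0 ?B0.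
- move=> e m n e0; rewrite 2!szlenk_iterE => A0 B0; apply: empty; rewrite -subset0 => p.
  move=> /(box_boundM (@box_bound_oexp _ _ _ _ xi) clA clB)[i [j [ijE Ai Bj]]].
  (* Since [i + j = m + n], either [m <= i] or [n <= j], and the corresponding iterate is empty. *)
  have [mi|im] := leqP m i.
    by move: (der_iter_omul (ole_ofnat mi) Ai); rewrite A0.
  have [nj|jn] := leqP n j.
    by move: (der_iter_omul (ole_ofnat nj) Bj); rewrite B0.
  by have := leq_add (ltnW im) jn; rewrite addnS ijE ltnn.
Qed.

Lemma p_op_embedding_le xi X Y Z (A : operator X Y) (j : operator Y Z) :
  isometric_embedding j -> (p_op xi A <= p_op xi (op_comp j A))%E.
Proof.
move=> jiso; have sub : dual_image A `<=` dual_image (op_comp j A).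
  move=> _ [g g1 <-]; have [h [h1 hg]] := hahn_banach jiso g1.
  by exists h => //; apply: operator_ext => x /=; rewrite hg.
have empty eps z : szlenk_iter eps (dual_image (op_comp j A)) z = set0 ->
    szlenk_iter eps (dual_image A) z = set0.
  by move=> jz; rewrite -subset0 -jz; exact: szlenk_subset.
rewrite -[leRHS]maxxx; apply: (@p_set_le _ _ _ 1); try exact: dual_image_neq0.
- by [].
- by move=> e e0 + _; rewrite divr1; exact: empty.
- move=> e m n e0 jm _; apply: empty; rewrite -subset0 -jm divr1.
  by apply: szlenk_iter_omul; exact: leq_addr.
Qed.

(** A vector of norm at most one need not lift to one of norm at most one. The strict inequality
    [eps < v] leaves room for a lift of norm below [v / eps], which is then rescaled into the unit
    ball while the difference stays above [eps]. *)
Lemma apart_quotient W X (q : operator W X) (eps : R) (f g : dual X) :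
  quotient_map q -> 0 < eps -> apart eps f g -> apart eps (adjoint q f) (adjoint q g).
Proof.
move=> [qsurj qnorm] e0 [x x1 xfg]; set v := rnorm _ in xfg.
have v0 : 0 < v by exact: lt_trans xfg.
have [w wx] := qsurj x.
have : inf [set rnorm (w - k) | k in [set k | q k = 0]] < v / eps.
  by rewrite -qnorm wx (le_lt_trans x1)// ltr_pdivlMr// mul1r.
move=> /inf_lt[|_ [k qk <-] kv].
  by exists (rnorm (w - 0)), 0 => //=; rewrite linear0.
(* Scaling by the midpoint rather than by the norm of the lift ensures a positive divisor. *)
pose s := (rnorm (w - k) + v / eps) / 2.
have ks : rnorm (w - k) < s by rewrite /s; lra.
have sv : s < v / eps by rewrite /s; lra.
have s0 : 0 < s by exact: le_lt_trans (rnorm_ge0 _) ks.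
have nV : rnorm (of_real s^-1 : K^o) = s^-1.
  by rewrite rnorm_of_real gtr0_norm ?invr_gt0.
exists ((of_real s^-1 : K) *: (w - k)).
  by rewrite rnormZ nV ler_pdivrMl// mulr1 ltW.
rewrite /= [q _]linearZ linearB /= qk subr0 wx rnorm_dualZ nV.
by rewrite mulrC ltr_pdivlMr// mulrC -ltr_pdivlMr.
Qed.

Lemma p_op_quotient_le xi W X Y (A : operator X Y) (q : operator W X) :
  quotient_map q -> (p_op xi A <= p_op xi (op_comp A q))%E.
Proof.
move=> qq.
(* The adjoint of [q] is weak* continuous and keeps pairs apart at the same [eps], so it carries
   derived points to derived points. *)
have sub eps z : 0 < eps -> adjoint q @` szlenk_iter eps (dual_image A) z `<=`
    szlenk_iter eps (dual_image (op_comp A q)) z.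
  move=> e0; rewrite !szlenk_iterE; elim: z => [|z ih|J f ih].
  - by move=> _ [_ [h h1 <-] <-]; exists h => //; exact: operator_ext.
  - move=> _ [f [Sf ffar] <-]; split; first by apply: ih; exists f.
    move=> V nV; have [g [h [Vg Sg Vh Sh gh]]] := ffar _ (@adjoint_continuous _ _ q f _ nV).
    exists (adjoint q g), (adjoint q h); split=> //.
    + by apply: ih; exists g.
    + by apply: ih; exists h.
    + exact: apart_quotient.
  - move=> _ [g [Sg fg] <-]; split.
      by have [h h1 <-] := Sg; exists h => //; exact: operator_ext.
    by move=> i _; apply: ih; exists g => //; exact: fg.
have empty eps z : 0 < eps -> szlenk_iter eps (dual_image (op_comp A q)) z = set0 ->
    szlenk_iter eps (dual_image A) z = set0.
  move=> e0 qz; rewrite -subset0 => f Sf.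
  by have : set0 (adjoint q f) by rewrite -qz; apply: sub => //; exists f.
rewrite -[leRHS]maxxx; apply: (@p_set_le _ _ _ 1); try exact: dual_image_neq0.
- by [].
- by move=> e e0 + _; rewrite divr1; exact: empty.
- move=> e m n e0 jm _; apply: empty => //; rewrite -subset0 -jm divr1.
  by apply: szlenk_iter_omul; exact: leq_addr.
Qed.

End operators.

(** * Finite rank operators *)

Section finite_rank.
Context {R : realType} {c : scalar_kind}.
Local Notation K := (base_field R c).
Implicit Types W X Y Z : normedModType K.

Lemma szlenk_iter_oexp_sub xi X eps (S : set (dual X)) :
  szlenk_iter eps S (oexp xi) `<=` szlenk_iter eps S (ofnat 1).
Proof.
rewrite !szlenk_iterE; elim: xi S => [|xi ih|J f ih] S //.
  by move=> f /= [_ /(_ 1%N Logic.I)]; rewrite /= der_iter_add; exact: ih.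
by move=> g [_ /(_ None Logic.I)].
Qed.

(** Every power of omega is at least 1, so the index of [S] is at most 1 for each [eps] and its
    logarithm is at most 0. *)
Lemma p_set_le0 xi X (S : set (dual X)) :
  (forall eps, 0 < eps -> szlenk_derivation eps S = set0) -> (p_set xi S <= 0)%E.
Proof.
move=> S0; have S1 eps k : 0 < eps -> szlenk_iter eps S (oexp k) = set0.
  move=> e0; rewrite -subset0 => f /szlenk_iter_oexp_sub /=.
  by rewrite S0.
rewrite /p_set asboolT; last by apply/Sz_le => eps; exact: S1.
apply: le_trans (ereal_inf_lbound _) _.
  exists [set eps : R | 0 < eps]; last by [].
  by near=> e; near: e; exact: nbhs_right_gt.
apply: ge_ereal_sup => _ [eps /= e0 <-].
apply: mule_le0_ge0; last by rewrite lee_fin invr_ge0.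
rewrite lne_le0; apply: (@szlenk_index_le R c xi X S eps 1).
by rewrite szlenk_iterE /= der_iter_add /= -szlenk_iterE S1.
Unshelve. all: by end_near. Qed.

Lemma rank_one_operator X Y (f : dual X) (y : Y) :
  {P : operator X Y | forall x, P x = (f x : K) *: y}.
Proof.
have [C C0 fC] := cid2 (operator_bounded f).
apply: (@mk_operator R c X Y (fun x => (f x : K) *: y) (C * rnorm y)).
- by move=> x x'; rewrite linearD scalerDl.
- by move=> a x; rewrite linearZ /= -scalerA.
- by move=> x; rewrite rnormZ mulrAC ler_wpM2r ?rnorm_ge0.
Qed.

(** On the line spanned by [f], evaluation at one [x0] with [f x0] nonzero determines the
    coefficient, so small weak* neighbourhoods have small diameter. *)
Lemma p_op_rank_one xi X Y (A : operator X Y) (f : dual X) (y : Y) :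
  (forall x, A x = (f x : K) *: y) -> (p_op xi A <= 0)%E.
Proof.
move=> AE; apply: p_set_le0 => eps e0; rewrite szlenk_derivationE -subset0 => g [Sg gfar].
have SE h : dual_image A h -> exists a : K, forall x, h x = a * (f x : K).
  by move=> [k _ <-]; exists (k y) => x; rewrite /= AE linearZ /= mulrC.
have [f0|/existsNP[x0 /eqP fx0]] := pselect (forall x, f x = 0).
  have [h [k [_ /SE[a ha] _ /SE[b hb] [x _]]]] := gfar setT filterT.
  by rewrite ha hb f0 !mulr0 subrr rnorm0 ltNge ltW.
have [C C0 fC] := operator_bounded f.
have nfx0 : 0 < rnorm (f x0 : K^o) by rewrite rnorm_gt0.
(* Coefficients of two members of [V] differ by at most [2 * d / rnorm (f x0)]; multiplied by the
   bound [C] of [f], this is [eps]. *)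
pose d := eps * rnorm (f x0 : K^o) / (2 * C).
have d0 : 0 < d by rewrite divr_gt0 ?mulr_gt0.
pose V : set (wstar X) := [set h | rnorm ((g : dual X) x0 - (h : dual X) x0 : K^o) < d].
have nV : nbhs (g : wstar X) V.
  apply: (@eval_continuous R c X x0 g
    [set a : K^o | rnorm ((g : dual X) x0 - a : K^o) < d]).
  have d0' : 0 < of_real d :> K by rewrite -(rmorph0 (@of_real R c)) ltr_of_real.
  apply: filterS (nbhsx_ballx ((g : dual X) x0 : K^o) (of_real d) d0') => a.
  by rewrite -ball_normE /= norm_of_real ltr_of_real.
have [h [k [Vh /SE[a ha] Vk /SE[b kb] [x x1]]]] := gfar V nV.
have hk z : rnorm ((h : dual X) z - (k : dual X) z : K^o) = rnorm (a - b : K^o) * rnorm (f z : K^o).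
  by rewrite ha kb -rnormM mulrBl.
apply/negP; rewrite -leNgt hk; apply: (@le_trans _ _ (rnorm (a - b : K^o) * C)).
  rewrite ler_wpM2l ?rnorm_ge0//; apply: le_trans (fC x) _.
  by rewrite ler_piMr// ltW.
have : rnorm (a - b : K^o) * rnorm (f x0 : K^o) <= 2 * d.
  rewrite -hk.
  have := rnormB ((g : dual X) x0 - (k : dual X) x0 : K^o) ((g : dual X) x0 - (h : dual X) x0).
  rewrite opprB addrC subrKA; move: Vh Vk; rewrite /V /=; lra.
rewrite -ler_pdivlMr//; move=> /(ler_wpM2r (ltW C0)) /le_trans; apply.
have -> // : 2 * d / rnorm (f x0 : K^o) * C = eps.
by rewrite /d; field; rewrite !gt_eqF.
Qed.

(** Hahn-Banach is applied to the isometric embedding of the scalars onto the line of [y], with the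
    identity as the functional to extend. *)
Lemma separating_functional Y (y : Y) : y != 0 -> exists g : dual Y, g y != 0.
Proof.
move=> y0; have ry : 0 < rnorm y by rewrite rnorm_gt0.
pose u : Y := (of_real (rnorm y)^-1 : K) *: y.
have u1 : rnorm u = 1.
  by rewrite rnormZ rnorm_of_real gtr0_norm ?invr_gt0// mulVf// gt_eqF.
have [|||j jE] := @mk_operator R c K^o Y (fun t => (t : K) *: u) 1.
- by move=> s t; rewrite scalerDl.
- by move=> a t; exact/esym/scalerA.
- by move=> t; rewrite rnormZ u1 mulr1 mul1r.
have [|||i iE] := @mk_operator R c K^o K^o id 1; try by [].
  by move=> t; rewrite mul1r.
have [||g [_ gj]] := @hahn_banach R c _ _ j i.
- by move=> t; rewrite !norm_of_real jE rnormZ u1 mulr1.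
- by apply/dual_ballP => t; rewrite iE.
exists g; apply/eqP => gy0; have := gj 1.
by rewrite jE scale1r linearZ /= gy0 scaler0 iE => /eqP; rewrite eq_sym oner_eq0.
Qed.

(* Subtracting from [A] the rank one operator [x |-> g (A x) y1], where
   [g y1 = 1], puts its range in the hyperplane [g = 0] of the span of [v]. *)
Lemma p_op_finite_rank xi X Y (A : operator X Y) : finite_rank A -> (p_op xi A <= 0)%E.
Proof.
have null (B : operator X Y) : (forall x, B x = 0) -> (p_op xi B <= 0)%E.
  move=> B0; have [f _] := dual_image_neq0 B.
  by apply: (@p_op_rank_one xi X Y B f 0) => x; rewrite scaler0.
move=> [n]; elim: n A => [|n ih] A [v Av].
  by apply: null => x; have [a ->] := Av x; rewrite big_ord0.
have [A0|/existsNP[x0 /eqP Ax0]] := pselect (forall x, A x = 0); first exact: null.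
have [g gx0] := separating_functional Ax0.
have AZ t x : A (t *: x) = t *: A x by rewrite linearZ.
pose gK y : K := g y.
have gZ t y : gK (t *: y) = t * gK y by rewrite /gK linearZ.
have gB y y' : gK (y - y') = gK y - gK y' by rewrite /gK linearB.
have gsum m (a : 'I_m -> K) (w : 'I_m -> Y) :
    gK (\sum_(i < m) a i *: w i) = \sum_(i < m) a i * gK (w i).
  by rewrite /gK linear_sum; apply: eq_bigr => i _; exact: gZ.
have [z gz] : exists z, gK (A z) = 1.
  by exists ((gK (A x0))^-1 *: x0); rewrite AZ gZ mulVf.
have [P PE] := rank_one_operator (adjoint A g) (A z).
(* Subtraction is expressed by adding the opposite rank one operator, with [A z] in the role of the
   vector on which [g] equals 1. *)
have [N NE] := rank_one_operator (adjoint A g) (- A z).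
have -> : A = op_add (op_add A N) P.
  by apply: operator_ext => x /=; rewrite PE NE scalerN subrK.
apply: le_trans (p_op_add_le xi _ _) _; rewrite ge_max (p_op_rank_one xi PE) andbT.
have [k gvk] : exists k, gK (v k) != 0.
  apply: contrapT => /forallNP h; have [a Ex0] := Av x0.
  have : gK (A x0) != 0 by [].
  rewrite Ex0 gsum big1 ?eqxx// => i _.
  by move/negP: (h i); rewrite negbK => /eqP ->; rewrite mulr0.
(* Each remaining vector is corrected by a multiple of [v k] so that [g] vanishes on it; these [n]
   vectors span the hyperplane. *)
apply: ih; exists (fun i => v (lift k i) - (gK (v (lift k i)) / gK (v k)) *: v k) => x.
have Nx : op_add A N x = A (x - gK (A x) *: z).
  by rewrite /= NE scalerN linearB AZ.
have [a Ea] := Av (x - gK (A x) *: z).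
have g0 : gK (\sum_(i < n.+1) a i *: v i) = 0.
  by rewrite -Ea linearB AZ gB gZ gz mulr1 subrr.
exists (fun i => a (lift k i)); rewrite Nx Ea.
(* Since [g] vanishes on the sum, the coefficient of [v k] is determined by the others. *)
have gkE : \sum_(i < n) a (lift k i) * gK (v (lift k i)) = - (a k * gK (v k)).
  apply/eqP; rewrite -addr_eq0 addrC; apply/eqP; rewrite -[RHS]g0 gsum (bigD1_ord k)//.
rewrite (bigD1_ord k)//=.
under [RHS]eq_bigr => i _ do rewrite scalerBr scalerA mulrA.
by rewrite sumrB -scaler_suml -mulr_suml gkE mulNr mulfK// scaleNr opprK addrC.
Qed.

End finite_rank.

Theorem corollary6p2 (R : realType) (c : scalar_kind) (xi : ord) :
  [/\ (forall (W X Y Z : completeNormedModType (base_field R c))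
         (A : operator Y Z) (B : operator X Y) (C : operator W X),
         (p_op xi (op_comp A (op_comp B C)) <= p_op xi B)%E),
      (forall (W X Y Z : completeNormedModType (base_field R c))
         (A : operator X Y) (q : operator W X) (j : operator Y Z),
         quotient_map q -> isometric_embedding j ->
         p_op xi (op_comp j (op_comp A q)) = p_op xi A),
      (forall (X Y : completeNormedModType (base_field R c)) (A B : operator X Y),
         (p_op xi (op_add A B) <= maxe (p_op xi A) (p_op xi B))%E)
    & (forall p : R, 1 <= p ->
         let U : operator_class (base_field R c) :=
           fun X Y (A : operator X Y) => (p_op xi A <= p%:E)%E in
         [/\ operator_ideal U, injective_class U & surjective_class U])].
Proof.
have embedding X Y Z (A : operator X Y) (j : operator Y Z) :=
  @p_op_embedding_le R c xi X Y Z A j.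
have quotient W X Y (A : operator X Y) (q : operator W X) :=
  @p_op_quotient_le R c xi W X Y A q.
split=> [W X Y Z A B C|W X Y Z A q j hq hj|X Y A B|p p1 U].
- exact: p_op_comp_le.
- apply/eqP; rewrite eq_le p_op_comp_le /=.
  (* The quotient is handled first, then [j] is applied to the composite of [A] and [q]. *)
  exact: le_trans (quotient _ _ _ A q hq) (embedding _ _ _ _ _ hj).
- exact: p_op_add_le.
split.
- split=> [X Y A|X Y A B UA UB|W X Y Z A B C].
  + move=> /(p_op_finite_rank xi) /le_trans; apply.
    by rewrite lee_fin (le_trans ler01).
  + by apply: le_trans (p_op_add_le xi A B) _; rewrite ge_max UA UB.
  + exact: le_trans (p_op_comp_le xi A B C).
- by move=> X Y Z A j hj; exact: le_trans (embedding _ _ _ A j hj).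
- by move=> W X Y A q hq; exact: le_trans (quotient _ _ _ A q hq).
Qed.
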